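(* Consider the series whose $N$-th partial sum is $$g_N^0(x,\alpha,\theta)=\frac{1}{\alpha\pi}\sum_{n=0}^{N-1}\frac{x^n}{n!}\,\Gamma\left(\frac{n+1}{\alpha}\right)\sin\left(\tfrac{\pi}{2}(n+1)(1-\theta)\right).$$ (1) In the case $\alpha<1$ this series is divergent as $N\to\infty$. In this case, for any admissible $\theta$, the density $g(x,\alpha,\theta)$ of the standard strictly stable law has the asymptotic expansion $$g(x,\alpha,\theta)\sim\frac{1}{\alpha\pi}\sum_{n=0}^{N-1}\frac{x^n}{n!}\,\Gamma\left(\frac{n+1}{\alpha}\right)\sin\left(\tfrac{\pi}{2}(n+1)(1-\theta)\right),\quad x\to0.$$ (2) In the case $\alpha=1$ the series converges for any $x$ satisfying $|x|<1$. In this case, for any admissible $\theta\neq\pm1$, the density is represented by the infinite series $$g(x,1,\theta)=\frac{1}{\pi}\sum_{n=0}^{\infty}\sin\left(\tfrac{\pi}{2}(n+1)(1-\theta)\right)x^n,\quad |x|<1.$$ (3) In the case $\alpha>1$ the series converges for any $x$. In this case, for any admissible $\theta$, the density is represented by the infinite series $$g(x,\alpha,\theta)=\frac{1}{\alpha\pi}\sum_{n=0}^{\infty}\frac{x^n}{n!}\,\Gamma\left(\frac{n+1}{\alpha}\right)\sin\left(\tfrac{\pi}{2}(n+1)(1-\theta)\right).$$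
   Context: The standard strictly stable law with parameters $(\alpha,\theta)$ (parameterization ''C'', scale $\lambda=1$) is the probability law on $\mathbf{R}$ with characteristic function $$\hat g(t,\alpha,\theta)=\exp\left\{-|t|^\alpha\exp\{-i\tfrac{\pi}{2}\alpha\theta\,\mathrm{sign}\,t\}\right\},\quad t\in\mathbf{R}.$$ The parameters are called admissible if $\alpha\in(0,2]$ and $|\theta|\leqslant\min(1,2/\alpha-1)$. Its probability density is $g(x,\alpha,\theta)=\frac{1}{2\pi}\int_{-\infty}^{\infty}e^{-itx}\hat g(t,\alpha,\theta)\,dt$. Here $x$ is real and $\Gamma$ is the Euler gamma function. The relation $g\sim g_N^0$, $x\to0$, is meant in the sense of asymptotic series: for every fixed $N$, $g(x,\alpha,\theta)=g_N^0(x,\alpha,\theta)+O(x^N)$ as $x\to0$.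
   Formalization: In (1), divergence is claimed only for x ≠ 0 and θ ≠ ±1: at θ = ±1 every sine factor vanishes, and at x = 0 at most one term is nonzero, so the series converges there. *)

(* Defs.v *)
From HB Require Import structures.
From mathcomp Require Import all_boot all_order all_algebra.
From mathcomp Require Import complex.
From mathcomp Require Import all_classical all_reals all_analysis.

Set Implicit Arguments.
Unset Strict Implicit.
Unset Printing Implicit Defensive.

Import Order.TTheory GRing.Theory Num.Theory.
Import numFieldNormedType.Exports.

Local Open Scope classical_set_scope.
Local Open Scope ring_scope.
Local Open Scope complex_scope.

Definition cexp (R : realType) (z : R[i]) : R[i] :=
  (expR (complex.Re z))%:C * (cos (complex.Im z) +i* sin (complex.Im z)).

(* Lebesgue integral over the whole line of a complex-valued function, taken
   componentwise; meaningful when both components are integrable. *)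
Definition cintegral (R : realType) (f : R -> R[i]) : R[i] :=
  (\int[lebesgue_measure]_(t in [set: R]) complex.Re (f t)) +i*
  (\int[lebesgue_measure]_(t in [set: R]) complex.Im (f t)).

(* Euler's integral; meaningful for [0 < s]. *)
Definition Gamma (R : realType) (s : R) : R :=
  \int[lebesgue_measure]_(t in `]0, +oo[%classic) (t `^ (s - 1) * expR (- t)).

Definition admissible (R : realType) (alpha theta : R) : Prop :=
  0 < alpha <= 2 /\ `|theta| <= Num.min 1 (2 / alpha - 1).

(* Characteristic function of the standard strictly stable law, parameterization
   "C" with scale 1. *)
Definition stable_charfun (R : realType) (t alpha theta : R) : R[i] :=
  cexp (- ((`|t| `^ alpha)%:C *
           cexp (- ('i * (pi / 2 * alpha * theta * Num.sg t)%:C)))).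

(* Density of that law, by Fourier inversion.  The formula is complex-valued, so
   an identity with a real right-hand side also says that the imaginary part
   vanishes. *)
Definition stable_density (R : realType) (x alpha theta : R) : R[i] :=
  ((2 * pi)^-1)%:C *
  cintegral (fun t : R =>
    cexp (- ('i * (t * x)%:C)) * stable_charfun t alpha theta).

Definition stable_partial_sum (R : realType) (N : nat) (x alpha theta : R) : R :=
  (alpha * pi)^-1 *
  \sum_(0 <= n < N)
     (x ^+ n / n`!%:R * Gamma (n.+1%:R / alpha) *
      sin (pi / 2 * n.+1%:R * (1 - theta))).

(* Main.v *)
Require Import Defs.
From HB Require Import structures.
From mathcomp Require Import all_boot all_order all_algebra.
From mathcomp Require Import complex ring lra.
From mathcomp Require Import all_classical all_reals all_analysis.
From mathcomp Require Import measurable_realfun.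

Set Implicit Arguments.
Unset Strict Implicit.
Unset Printing Implicit Defensive.

Import Order.TTheory GRing.Theory Num.Theory.
Import numFieldNormedType.Exports.

Local Open Scope classical_set_scope.
Local Open Scope ring_scope.
Local Open Scope complex_scope.

(* On the half line the density is (1/pi) Re of the integral of
   exp(-itx) exp(-t^alpha e^{-i psi}), with psi = pi alpha theta / 2 and
   |psi| < pi/2.  Replacing exp(-itx) by its Taylor polynomial of order N costs at
   most |x|^N/N! times the N-th moment of exp(-t^alpha cos psi).  The moments of
   exp(-t^alpha e^{-i psi}) are obtained without contour integration: once the phase
   is corrected by s psi, s = (n+1)/alpha, the derivative in psi of the integrand is
   the derivative in t of a function vanishing at 0 and at infinity, so the integral
   does not depend on psi; at psi = 0 it is Gamma(s)/alpha.

   The error bound is the asymptotic expansion.  For alpha > 1 it tends to 0, since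
   exp(-c t^alpha) <= C exp(-L t) for every L.  For alpha < 1 the reverse comparison
   exp(-t^alpha) >= c exp(-|x| t) keeps x^n Gamma((n+1)/alpha)/n! away from 0.  For
   alpha = 1 the density and the series are both computed in closed form. *)

(** * Integrals over the half line *)

Section half_line.
Context {R : realType}.
Local Notation mu := (@lebesgue_measure R).
Implicit Types (f F : R -> R) (a p alpha t l : R).

(** The source of the integrable majorants: the exponential beats [y^k / k^k] with [y = a t^alpha],
    and [k] is chosen so large that [(t^alpha)^k] dominates [t^(p + 2)] for [t >= 1]. *)
Lemma powR_expR_le p a alpha : 0 <= p -> 0 < a -> 0 < alpha ->
  exists2 C, 0 <= C &
    forall t, 0 < t -> t `^ p * expR (- (a * t `^ alpha)) <= C / oneDsqr t.
Proof.
move=> p0 a0 al0.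
pose k := (Num.truncn ((p + 2) / alpha)).+1.
have kP : p + 2 <= alpha * k%:R.
  by rewrite mulrC -ler_pdivrMr// ltW// truncnS_gt.
have k0 : 0 < k%:R :> R by rewrite ltr0n.
(* The factor 2 comes from [1 + t^2 <= 2 t^2] for [t >= 1] and from [1 + t^2 <= 2] for [t < 1]; the
   power comes from [t^alpha = (k / a) (y / k)]. *)
exists (2 * (1 + (k%:R / a) ^+ k)).
  by rewrite mulr_ge0// addr_ge0// exprn_ge0// divr_ge0// ltW.
move=> t t0; have D0 : 0 < oneDsqr t by rewrite (lt_le_trans ltr01)// oneDsqr_ge1.
have ka0 : 0 <= (k%:R / a) ^+ k by rewrite exprn_ge0// divr_ge0// ltW.
rewrite ler_pdivlMr// expRN -mulrAC ler_pdivrMr ?expR_gt0//.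
set y := a * t `^ alpha.
have y0 : 0 <= y by rewrite mulr_ge0 ?powR_ge0// ltW.
have ey1 : 1 <= expR y by rewrite -[1]expR0 ler_expR.
have [t1|t1] := leP 1 t.
  have tD : oneDsqr t <= 2 * t ^+ 2.
    by rewrite /oneDsqr mulr2n mulrDl mul1r lerD2r expr_ge1// ltW.
  have -> : t `^ p * oneDsqr t = oneDsqr t * t `^ p by rewrite mulrC.
  have H1 : oneDsqr t * t `^ p <= 2 * t `^ (p + 2).
    rewrite powRD ?(gt_eqF t0) ?implybT// mulrCA mulrC ler_wpM2l ?powR_ge0//.
    by rewrite -(powR_mulrn 2) ?(ltW t0)// in tD *.
  apply: (le_trans H1); rewrite -mulrA ler_wpM2l//.
  have H2 : t `^ (p + 2) <= t `^ (alpha * k%:R) by rewrite ler_powR.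
  apply: (le_trans H2).
  rewrite powRrM powR_mulrn ?powR_ge0//.
  have -> : t `^ alpha = (k%:R / a) * (y / k%:R).
    by rewrite /y; field; rewrite !gt_eqF.
  rewrite exprMn mulrDl mul1r.
  (* This is [1 + z <= expR z] at [z = y / k], raised to the power [k]. *)
  have H3 : (y / k%:R) ^+ k <= expR y.
    have -> : expR y = expR (y / k%:R) ^+ k.
      by rewrite -expRM_natl; congr expR; field; rewrite gt_eqF.
    rewrite lerXn2r ?nnegrE ?expR_ge0 ?(divr_ge0 y0 (ltW k0))//.
    by rewrite (le_trans _ (expR_ge1Dx _))// lerDr.
  by rewrite ler_wpDl ?expR_ge0// ler_wpM2l.
have tp : t `^ p <= 1.
  by have := @ge0_ler_powR R p p0 t 1; rewrite powR1 !nnegrE; apply; rewrite ?ltW.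
have tD : oneDsqr t <= 2.
  by rewrite /oneDsqr mulr2n lerD2l exprn_ile1// ltW.
rewrite -mulrA (@le_trans _ _ (1 * 2))//; first by rewrite ler_pM ?powR_ge0 ?(ltW D0).
rewrite mulrC ler_pM2l// (@le_trans _ _ (1 * 1)) ?mulr1//.
by rewrite -[X in X <= _]mulr1 ler_pM// lerDl.
Qed.

Lemma continuous_oy_measurable f : {in `]0, +oo[, continuous f} ->
  measurable_fun (`]0, +oo[ : set R) f.
Proof.
move=> cf; apply: open_continuous_measurable_fun => //.
by move=> x /[!inE]; exact: cf.
Qed.

Lemma integrable_oneDsqrV : mu.-integrable `]0, +oo[ (fun t => ((oneDsqr t)^-1)%:E).
Proof.
apply: (@integrableS _ _ _ mu `[0, +oo[) => //.
  by apply: subset_itvr; rewrite bnd_simp.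
apply/integrableP; split.
  apply/measurable_EFinP; apply: measurable_funTS.
  by apply: continuous_measurable_fun; exact: continuous_oneDsqrV.
rewrite (@eq_integral _ _ _ mu _ (fun t => ((oneDsqr t)^-1)%:E)).
  by rewrite integral0y_oneDsqr ltry.
by move=> x _ /=; rewrite ger0_norm// invr_ge0 (le_trans ler01)// oneDsqr_ge1.
Qed.

Lemma integrable_stretched f p a alpha K :
  {in `]0, +oo[, continuous f} -> 0 <= p -> 0 < a -> 0 < alpha ->
  (forall t, 0 < t -> `|f t| <= K * (t `^ p * expR (- (a * t `^ alpha)))) ->
  mu.-integrable `]0, +oo[ (EFin \o f).
Proof.
move=> cf p0 a0 al0 fK.
have [C C0 CP] := powR_expR_le p0 a0 al0.
apply: (@le_integrable _ _ _ mu _ _ _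
  (EFin \o (fun t => (`|K| * C) * (oneDsqr t)^-1))) => //.
- by apply/measurable_EFinP; exact: continuous_oy_measurable.
- move=> t /=; rewrite in_itv/= andbT => t0.
  rewrite lee_fin (le_trans (fK _ t0))// (le_trans _ (ler_norm _))//.
  rewrite -mulrA (@le_trans _ _ (`|K| * (t `^ p * expR (- (a * t `^ alpha)))))//.
    by rewrite ler_wpM2r ?ler_norm// mulr_ge0 ?powR_ge0 ?expR_ge0.
  by rewrite ler_wpM2l// CP.
- under [X in mu.-integrable _ X]eq_fun do rewrite /= EFinM.
  apply: (@integrableZl _ _ R mu _ _ (`|K| * C) (fun t => ((oneDsqr t)^-1)%:E)) => //.
  exact: integrable_oneDsqrV.
Qed.

Lemma nbhs_infty_gerS (r : R) : \forall n \near \oo, r <= n.+1%:R.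
Proof.
near=> n; rewrite (@le_trans _ _ n%:R) ?ler_nat//.
by near: n; exact: nbhs_infty_ger.
Unshelve. end_near. Qed.

(** Dominated convergence with [|f|] as majorant. The compact intervals avoid 0, where a real power
    of [t] need not be differentiable. *)
Lemma Rintegral_exhaust f :
  mu.-integrable `]0, +oo[ (EFin \o f) ->
  \int[mu]_(t in `[k.+1%:R^-1, k.+1%:R]) f t @[k --> \oo] -->
  \int[mu]_(t in `]0, +oo[) f t.
Proof.
move=> intf.
have mf := measurable_int _ intf.
pose S k : set R := `[k.+1%:R^-1, k.+1%:R]%classic.
have SS k : S k `<=` `]0, +oo[.
  move=> t; rewrite /S/= !in_itv/= andbT => /andP[h _].
  by rewrite (lt_le_trans _ h)// invr_gt0.
pose f_ k : R -> \bar R := (EFin \o f) \_ (S k).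
have mfk k : measurable_fun (`]0, +oo[ : set R) (f_ k).
  apply/measurable_restrict => //.
    exact: measurable_itv.
  by rewrite setIidr; [apply: measurable_funS mf => //; exact: SS|exact: SS].
have cfk : {ae mu, forall x, `]0%R, +oo[%classic x ->
    f_ ^~ x @ \oo --> (EFin \o f) x}.
  apply: aeW => x; rewrite /= in_itv/= andbT => x0; apply: cvg_near_cst.
  near=> k; rewrite /f_ patchE mem_set// /S/= in_itv/=; apply/andP; split.
    rewrite -[leRHS]invrK lef_pV2 ?posrE ?invr_gt0//.
    by near: k; apply: (@nbhs_infty_gerS _).
  by near: k; apply: (@nbhs_infty_gerS _).
have f_f : {ae mu, forall x n, `]0%R, +oo[%classic x ->
    (`|f_ n x| <= (abse \o (EFin \o f)) x)%E}.
  apply: aeW => x n _; rewrite /f_ patchE /=; case: ifP => //= _.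
  by rewrite normr0 lee_fin.
have [_ _] := @dominated_convergence _ _ R mu `]0, +oo[ (measurable_itv _)
  f_ (EFin \o f) (abse \o (EFin \o f)) mfk mf cfk (integrable_abse intf) f_f.
rewrite -[X in _ --> X -> _](fineK (integrable_fin_num _ intf))//.
move/fine_cvg; apply: cvg_trans; apply: near_eq_cvg; near=> k.
by rewrite /= /Rintegral /f_ -integral_mkcondr setIidr//; exact: SS.
Unshelve. all: end_near. Qed.

Lemma Rintegral_oy_FTC f F l0 l :
  mu.-integrable `]0, +oo[ (EFin \o f) -> {in `]0, +oo[, continuous f} ->
  (forall t, 0 < t -> is_derive t 1 F (f t)) ->
  F t @[t --> 0^'+] --> l0 -> F t @[t --> +oo] --> l ->
  \int[mu]_(t in `]0, +oo[) f t = l - l0.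
Proof.
move=> intf cf dF F0 Fy.
(* The endpoints start at 2, since [k.+1] would give the degenerate interval [[1, 1]] at [k = 0]. *)
have invS (k : nat) : k.+2%:R^-1 < k.+2%:R :> R.
  by rewrite (@lt_trans _ _ 1) ?invf_lt1 ?ltr1n.
have cF t : 0 < t -> {for t, continuous F}.
  move=> /dF[dt _]; exact/differentiable_continuous/derivable1_diffP.
have H k : \int[mu]_(t in `[k.+2%:R^-1, k.+2%:R]) f t = F k.+2%:R - F k.+2%:R^-1.
  have invS0 : 0 < k.+2%:R^-1 :> R by rewrite invr_gt0.
  rewrite /Rintegral (@continuous_FTC2 _ f F)//.
  - apply: continuous_in_subspaceT => t /[!inE]/=; rewrite in_itv/= => /andP[kt _].
    by apply: cf; rewrite in_itv/= andbT (lt_le_trans invS0 kt).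
  - split.
    + move=> t; rewrite in_itv/= => /andP[kt _].
      by have [] := dF t (lt_trans invS0 kt).
    + by apply/cvg_at_right_filter/cF.
    + by apply/cvg_at_left_filter/cF.
  - move=> t; rewrite in_itv/= => /andP[kt _]; rewrite derive1E.
    by have [_ ->] := dF t (lt_trans invS0 kt).
have n_oo : (k.+2%:R : R) @[k --> \oo] --> +oo.
  by apply/cvgryPge => M; near=> k; rewrite (@le_trans _ _ k.+1%:R) ?ler_nat//;
     near: k; exact: nbhs_infty_gerS.
have H2 : (F k.+2%:R - F k.+2%:R^-1) @[k --> \oo] --> l - l0.
  apply: cvgB; first exact: (cvg_comp _ _ n_oo Fy).
  move/cvg_at_rightP : F0; apply; split; first by move=> k; rewrite invr_gt0.
  by apply/gtr0_cvgV0 => //; near=> k.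
have H1 : (F k.+2%:R - F k.+2%:R^-1) @[k --> \oo] -->
    \int[mu]_(t in `]0, +oo[) f t.
  under eq_fun do rewrite -H.
  by have := Rintegral_exhaust intf; rewrite -cvg_shiftS.
exact: (cvg_unique _ H1 H2).
Unshelve. all: end_near. Qed.
End half_line.

(** * Differentiation of closed formulas *)

Section lambda_derivatives.
Context {R : realType}.
Implicit Types (f g : R -> R) (x a b : R).

Lemma is_derive_continuous f x a : is_derive x 1 f a -> {for x, continuous f}.
Proof. by move=> [df _]; exact/differentiable_continuous/derivable1_diffP. Qed.

Lemma is_derive_cst_fun (c : R) x : is_derive x 1 (fun=> c) 0.
Proof. exact: is_derive_cst. Qed.

Lemma is_derive_id_fun x : is_derive x 1 (fun t : R => t) 1.
Proof. exact: is_derive_id. Qed.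

Lemma is_deriveD_fun f g x a b : is_derive x 1 f a ->
  is_derive x 1 g b -> is_derive x 1 (fun t => f t + g t) (a + b).
Proof. by move=> df dg; exact: is_deriveD. Qed.

Lemma is_deriveN_fun f x a : is_derive x 1 f a ->
  is_derive x 1 (fun t => - f t) (- a).
Proof. by move=> df; exact: is_deriveN. Qed.

Lemma is_deriveM_fun f g x a b : is_derive x 1 f a ->
  is_derive x 1 g b -> is_derive x 1 (fun t => f t * g t) (f x * b + g x * a).
Proof. by move=> df dg; exact: is_deriveM. Qed.

Lemma is_deriveX_fun n x :
  is_derive x 1 (fun t : R => t ^+ n) (n%:R * x ^+ n.-1).
Proof.
rewrite (_ : (fun _ => _) = id ^+ n); last by apply/funext => t; rewrite fctE.
by apply: is_derive_eq; rewrite /GRing.scale/= mulr1.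
Qed.

Lemma is_derive_expR_comp f x a : is_derive x 1 f a ->
  is_derive x 1 (fun t => expR (f t)) (expR (f x) * a).
Proof. by move=> df; exact: is_derive1_comp. Qed.

Lemma is_derive_cos_comp f x a : is_derive x 1 f a ->
  is_derive x 1 (fun t => cos (f t)) (- sin (f x) * a).
Proof. by move=> df; exact: is_derive1_comp. Qed.

Lemma is_derive_sin_comp f x a : is_derive x 1 f a ->
  is_derive x 1 (fun t => sin (f t)) (cos (f x) * a).
Proof. by move=> df; exact: is_derive1_comp. Qed.

End lambda_derivatives.
(* The library instances are stated for [f * g], [f \o g], ...; these ones let
   [is_derive_eq] differentiate closed formulas under a binder. *)
#[local] Existing Instances is_derive_cst_fun is_derive_id_fun is_deriveD_fun
  is_deriveN_fun is_deriveM_fun is_deriveX_fun is_derive_expR_comp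
  is_derive_cos_comp is_derive_sin_comp.

(** * Decay and integrability of the damped oscillating integrands *)

Section stretched.
Context {R : realType}.
Local Notation mu := (@lebesgue_measure R).
Implicit Types (a p alpha t psi delta : R).

Lemma stretched_cvgy p a alpha : 0 <= p -> 0 < a -> 0 < alpha ->
  t `^ p * expR (- (a * t `^ alpha)) @[t --> +oo] --> 0.
Proof.
move=> p0 a0 al0; have [C C0 CP] := powR_expR_le p0 a0 al0.
apply: (@squeeze_cvgr _ _ _ _ (cst 0) (fun t => C * (oneDsqr t)^-1)).
- near=> t; rewrite mulr_ge0 ?powR_ge0 ?expR_ge0//= CP//.
- exact: cvg_cst.
- rewrite -[X in _ --> X](mulr0 C); apply: cvgMr; apply/gtr0_cvgV0.
    by near=> t; rewrite (lt_le_trans ltr01)// oneDsqr_ge1.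
  apply: (@ger_cvgy _ _ _ _ id) => //; near=> t.
  rewrite /oneDsqr/= expr2 (@le_trans _ _ (t * t))//; last by rewrite lerDr.
  by rewrite ler_peMl.
Unshelve. all: end_near. Qed.

(* The real part of [t^n exp(- t^alpha e^{- i psi} + i delta)]. *)
Definition rotated alpha delta n psi t : R :=
  t ^+ n * expR (- (t `^ alpha * cos psi)) * cos (t `^ alpha * sin psi + delta).

Lemma rotated_le alpha delta n psi a t : 0 < t -> a <= cos psi ->
  `|rotated alpha delta n psi t| <= 1 * (t `^ n%:R * expR (- (a * t `^ alpha))).
Proof.
move=> t0 apsi; have tn0 : 0 <= t ^+ n by rewrite exprn_ge0// ltW.
rewrite /rotated (powR_mulrn n (ltW t0)) mul1r.
rewrite normrM normrM (ger0_norm (expR_ge0 _)) (ger0_norm tn0).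
rewrite -[leRHS]mulr1 ler_pM ?mulr_ge0 ?expR_ge0 ?cos_max//.
rewrite ler_wpM2l// ler_expR lerN2 mulrC.
by rewrite ler_wpM2l ?powR_ge0.
Qed.

Lemma rotated_continuous alpha delta n psi :
  {in `]0, +oo[, continuous (rotated alpha delta n psi)}.
Proof.
move=> t; rewrite in_itv/= andbT => t0.
have dt := is_derive1_powR alpha t0.
by apply: is_derive_continuous.
Qed.

Lemma rotated_integrable alpha delta n psi : 0 < alpha -> 0 < cos psi ->
  mu.-integrable `]0, +oo[ (EFin \o rotated alpha delta n psi).
Proof.
move=> al0 cpsi; apply: (integrable_stretched (p := n%:R) (K := 1) _ _ cpsi al0) => //.
  exact: rotated_continuous.
by move=> t t0; exact: rotated_le.
Qed.

End stretched.

(** * Rotating the path of integration *)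

Section rotation.
Context {R : realType}.
Local Notation mu := (@lebesgue_measure R).
Implicit Types (a p alpha t psi delta : R).

Lemma squeeze_norm0 {T : Type} (F : set_system T) {FF : Filter F} (f g : T -> R) :
  (\forall x \near F, `|f x| <= g x) -> g x @[x --> F] --> 0 ->
  f x @[x --> F] --> 0.
Proof.
move=> fg g0; apply: (@squeeze_cvgr _ _ _ _ (fun x => - g x) g) => //.
  by near=> x; rewrite -ler_norml; near: x.
by rewrite -oppr0; exact: cvgN.
Unshelve. all: end_near. Qed.

Lemma is_derive_0_itv_cst (f : R -> R) (u v x y : R) :
  (forall z, z \in `]u, v[ -> is_derive z 1 f 0) ->
  x \in `]u, v[ -> y \in `]u, v[ -> f x = f y.
Proof.
move=> df; wlog xy : x y / x <= y.
  move=> H; have [xy|/ltW yx] := leP x y; first exact: H.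
  by move=> xuv yuv; apply/esym/H.
rewrite !in_itv/= => /andP[ux xv] /andP[uy yv].
have uv z : x <= z <= y -> z \in `]u, v[.
  by move=> /andP[xz zy]; rewrite in_itv/= (lt_le_trans ux)// (le_lt_trans zy).
have dfxy z : z \in `]x, y[ -> is_derive z 1 f 0.
  by rewrite in_itv/= => /andP[xz zy]; apply/df/uv; rewrite !ltW.
have cfxy : {within `[x, y], continuous f}.
  apply: continuous_in_subspaceT => z /[!inE]/=; rewrite in_itv/= => /uv zuv.
  exact: is_derive_continuous (df z zuv).
have [c _] := @MVT_segment R f (fun=> 0) x y xy dfxy cfxy.
by rewrite mul0r => /eqP; rewrite subr_eq0 => /eqP.
Qed.

(* With [delta] depending on [psi] as [d - (n+1)/alpha * psi], both the derivative
   of [rotated] in [psi] and an exact derivative in [t]. *)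
Definition rotated_rate alpha delta n psi t : R :=
  t ^+ n * expR (- (t `^ alpha * cos psi)) *
  ((n.+1%:R / alpha - t `^ alpha * cos psi) * sin (t `^ alpha * sin psi + delta)
   + t `^ alpha * sin psi * cos (t `^ alpha * sin psi + delta)).

Lemma integrable_expn_stretched n a alpha : 0 < a -> 0 < alpha ->
  mu.-integrable `]0, +oo[ (EFin \o (fun t => t ^+ n * expR (- (a * t `^ alpha)))).
Proof.
move=> a0 al0; apply: (integrable_stretched (p := n%:R) (K := 1) _ _ a0 al0) => //.
  move=> t; rewrite in_itv/= andbT => t0.
  have dt := is_derive1_powR alpha t0.
  by apply: is_derive_continuous.
move=> t t0; rewrite (powR_mulrn n (ltW t0)) !mul1r ger0_norm//.
by rewrite mulr_ge0 ?expR_ge0// exprn_ge0// ltW.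
Qed.

Lemma integrable_expn_stretched1 n alpha : 0 < alpha ->
  mu.-integrable `]0, +oo[ (EFin \o (fun t => t ^+ n * expR (- t `^ alpha))).
Proof.
move=> al0; have := integrable_expn_stretched n ltr01 al0.
by under [X in EFin \o X]eq_fun do rewrite mul1r.
Qed.

Lemma is_derive_rotated_angle alpha d n t psi :
  is_derive psi 1
    (fun psi => rotated alpha (d - n.+1%:R / alpha * psi) n psi t)
    (rotated_rate alpha (d - n.+1%:R / alpha * psi) n psi t).
Proof.
rewrite /rotated /rotated_rate; apply: is_derive_eq.
by rewrite /GRing.scale/=; ring.
Qed.

(** Differentiating [t^(n+1)] brings down [n + 1] and differentiating [t^alpha] brings down [alpha];
    after division by [alpha] the result is the same rate as for the derivative in [psi]. *)
Lemma is_derive_rotated_primitive alpha delta n psi t : 0 < alpha -> 0 < t ->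
  is_derive t 1
    (fun t => alpha^-1 * (t ^+ n.+1 * expR (- (t `^ alpha * cos psi)) *
                          sin (t `^ alpha * sin psi + delta)))
    (rotated_rate alpha delta n psi t).
Proof.
move=> al0 t0; rewrite /rotated_rate; have dt := is_derive1_powR alpha t0.
apply: is_derive_eq; rewrite -(mulr_powRB1 (ltW t0) al0) /= exprS.
by rewrite /GRing.scale/=; field; rewrite gt_eqF.
Qed.

(** The bound sees [psi] only through the lower bound [a] of its cosine, so it can dominate the rate
    on a whole interval of angles, as differentiation under the integral requires. *)
Lemma rotated_rate_le alpha delta n psi a t : 0 < alpha -> 0 < t -> a <= cos psi ->
  `|rotated_rate alpha delta n psi t| <=
  n.+1%:R / alpha * (t `^ n%:R * expR (- (a * t `^ alpha))) +
  2 * (t `^ (n%:R + alpha) * expR (- (a * t `^ alpha))).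
Proof.
move=> al0 t0 apsi; rewrite /rotated_rate.
have tn0 : 0 <= t ^+ n by rewrite exprn_ge0// ltW.
have ta0 := powR_ge0 t alpha.
have s0 : 0 <= n.+1%:R / alpha by rewrite divr_ge0// ltW.
rewrite powRD ?(gt_eqF t0) ?implybT// (powR_mulrn n (ltW t0)).
set E := expR (- (a * _)).
have EE : expR (- (t `^ alpha * cos psi)) <= E.
  by rewrite ler_expR lerN2 mulrC ler_wpM2l.
rewrite normrM normrM (ger0_norm (expR_ge0 _)) (ger0_norm tn0).
have -> : n.+1%:R / alpha * (t ^+ n * E) + 2 * (t ^+ n * t `^ alpha * E) =
  (t ^+ n * E) * ((n.+1%:R / alpha + t `^ alpha) + t `^ alpha) by ring.
apply: ler_pM; rewrite ?mulr_ge0 ?expR_ge0//; first by rewrite ler_wpM2l.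
rewrite (le_trans (ler_normD _ _))// lerD// !normrM.
  rewrite -[leRHS]mulr1 ler_pM ?sin_max// (le_trans (ler_normB _ _))//.
  rewrite (ger0_norm s0) lerD2l normrM (ger0_norm ta0).
  by rewrite -[leRHS]mulr1 ler_wpM2l ?cos_max.
rewrite (ger0_norm ta0) -[leRHS]mulr1 ler_pM ?mulr_ge0 ?cos_max//.
by rewrite -[leRHS]mulr1 ler_wpM2l ?sin_max.
Qed.

Lemma integrable_rate_bound alpha n a : 0 < alpha -> 0 < a ->
  mu.-integrable `]0, +oo[ (EFin \o (fun t =>
    n.+1%:R / alpha * (t `^ n%:R * expR (- (a * t `^ alpha))) +
    2 * (t `^ (n%:R + alpha) * expR (- (a * t `^ alpha))))).
Proof.
move=> al0 a0.
have I (p : R) : 0 <= p -> mu.-integrable `]0, +oo[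
    (fun t => (t `^ p * expR (- (a * t `^ alpha)))%:E).
  move=> p0; apply: (integrable_stretched (p := p) (K := 1) _ p0 a0 al0).
    move=> t; rewrite in_itv/= andbT => t0.
    have dt := is_derive1_powR alpha t0; have dp := is_derive1_powR p t0.
    by apply: is_derive_continuous.
  by move=> t t0; rewrite mul1r ger0_norm// mulr_ge0 ?powR_ge0 ?expR_ge0.
rewrite (_ : _ \o _ = (fun t : R =>
   (n.+1%:R / alpha)%:E * (t `^ n%:R * expR (- (a * t `^ alpha)))%:E +
   2%:E * (t `^ (n%:R + alpha) * expR (- (a * t `^ alpha)))%:E)%E); last first.
  by apply/funext => t /=; rewrite EFinD !EFinM.
apply: integrableD => //.
  by apply: integrableZl => //; exact: I.
by apply: integrableZl => //; apply: I; rewrite addr_ge0// ltW.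
Qed.

(** The primitive vanishes at both ends: at 0 because of the factor [t^(n+1)], at infinity because
    of the exponential. *)
Lemma Rintegral_rotated_rate alpha delta n psi : 0 < alpha -> 0 < cos psi ->
  \int[mu]_(t in `]0, +oo[) rotated_rate alpha delta n psi t = 0.
Proof.
move=> al0 cpsi.
have cf : {in `]0, +oo[, continuous (rotated_rate alpha delta n psi)}.
  move=> t; rewrite in_itv/= andbT => t0.
  have dt := is_derive1_powR alpha t0.
  by rewrite /rotated_rate; apply: is_derive_continuous.
have If : mu.-integrable `]0, +oo[ (EFin \o rotated_rate alpha delta n psi).
  apply: (@le_integrable _ _ _ mu _ _ _ _ _ _ (integrable_rate_bound n al0 cpsi)) => //.
    by apply/measurable_EFinP; exact: continuous_oy_measurable.
  move=> t /=; rewrite in_itv/= andbT => t0.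
  rewrite lee_fin (le_trans _ (ler_norm _))//; exact: rotated_rate_le.
have Vle t : 0 < t -> `|alpha^-1 * (t ^+ n.+1 * expR (- (t `^ alpha * cos psi)) *
    sin (t `^ alpha * sin psi + delta))| <=
    alpha^-1 * (t `^ n.+1%:R * expR (- (cos psi * t `^ alpha))).
  move=> t0; have tn0 : 0 <= t ^+ n.+1 by rewrite exprn_ge0// ltW.
  rewrite (powR_mulrn n.+1 (ltW t0)).
  have ai0 : 0 <= alpha^-1 by rewrite invr_ge0 ltW.
  rewrite normrM (ger0_norm ai0) ler_wpM2l// normrM.
  rewrite ger0_norm ?mulr_ge0 ?expR_ge0// (mulrC (cos _)).
  by rewrite -[leRHS]mulr1 ler_wpM2l ?sin_max// mulr_ge0 ?expR_ge0.
rewrite (Rintegral_oy_FTC (l := 0) (l0 := 0) If cf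
  (fun t => @is_derive_rotated_primitive alpha delta n psi t al0)) ?subr0//.
  apply: squeeze_norm0; first by near=> t; apply: Vle; near: t; exact: nbhs_right_gt.
  rewrite -[X in _ --> X](mulr0 alpha^-1); apply: cvgMr.
  apply: (@squeeze_norm0 _ _ _ _ (fun t : R => t `^ n.+1%:R)); last first.
    by apply: powR_cvg0; rewrite ltr0n.
  near=> t; rewrite ger0_norm ?mulr_ge0 ?powR_ge0 ?expR_ge0// -[leRHS]mulr1.
  rewrite ler_wpM2l ?powR_ge0// -[leRHS]expR0 ler_expR oppr_le0.
  by rewrite mulr_ge0 ?powR_ge0// ltW.
apply: squeeze_norm0; first by near=> t; exact: Vle.
by rewrite -[X in _ --> X](mulr0 alpha^-1); apply: cvgMr; exact: stretched_cvgy.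
Unshelve. all: end_near. Qed.

(** With [s = (n + 1) / alpha], this is the real part, after multiplication by [e^(i delta)], of the
    identity stating that the integral of [t^n exp(- t^alpha e^(- i psi0))] equals [e^(i s psi0)]
    times its value at angle 0. *)
Lemma Rintegral_rotated alpha delta n psi0 : 0 < alpha -> `|psi0| < pi / 2 ->
  \int[mu]_(t in `]0, +oo[) rotated alpha delta n psi0 t =
  cos (delta + n.+1%:R / alpha * psi0) *
  \int[mu]_(t in `]0, +oo[) (t ^+ n * expR (- t `^ alpha)).
Proof.
move=> al0 psi0pi.
(* Halfway between [|psi0|] and [pi / 2]: the interval []-r, r[] contains both [psi0] and 0, and the
   cosine stays above [cos r > 0] on it. *)
pose r := (`|psi0| + pi / 2) / 2.
have r0 : `|psi0| < r < pi / 2 by rewrite /r; lra.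
have [r1 r2] := andP r0.
have rge0 : 0 <= r by rewrite (le_trans _ (ltW r1)).
have cr : 0 < cos r.
  rewrite cos_gt0_pihalf// r2 andbT (lt_le_trans _ rge0)//.
  by rewrite oppr_lt0 divr_gt0// pi_gt0.
have cos_ge psi : psi \in `]-r, r[ -> cos r <= cos psi.
  rewrite in_itv/= -ltr_norml => psir; rewrite -(cos_norm psi) leNgt ltr_cos.
  - by rewrite -leNgt ltW.
  - by rewrite in_itv/= rge0 (le_trans (ltW r2))// ler_pdivrMr// ler_pMr ?pi_gt0// ler1n.
  - rewrite in_itv/= normr_ge0 (le_trans (ltW psir))// (le_trans (ltW r2))//.
    by rewrite ler_pdivrMr// ler_pMr ?pi_gt0// ler1n.
(* Chosen so that the corrected phase is [delta] at [psi0]; at angle 0 it is then the constant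
   [d]. *)
pose d := delta + n.+1%:R / alpha * psi0.
pose K psi := rotated alpha (d - n.+1%:R / alpha * psi) n psi.
pose F psi := \int[mu]_(t in `]0, +oo[) K psi t.
have Ktderiv psi t : is_derive psi 1 (K^~ t)
    (rotated_rate alpha (d - n.+1%:R / alpha * psi) n psi t).
  exact: is_derive_rotated_angle.
have dK psi t : partial1of2 K psi t =
    rotated_rate alpha (d - n.+1%:R / alpha * psi) n psi t.
  by rewrite partial1of2E; have [_ ->] := Ktderiv psi t.
have dF psi : psi \in `]-r, r[ -> is_derive psi 1 F 0.
  move=> psir; have psir' : `]-r, r[%classic psi by [].
  have iK x : `]-r, r[%classic x -> mu.-integrable `]0, +oo[ (EFin \o K x).
    move=> /= xr; apply: rotated_integrable => //.
    by rewrite (lt_le_trans cr)// cos_ge.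
  have derK x y : `]-r, r[%classic x -> `]0, +oo[%classic y -> derivable (K^~ y) x 1.
    by move=> _ _; have [] := Ktderiv x y.
  have G0 (t : R) : 0 <= n.+1%:R / alpha * (t `^ n%:R * expR (- (cos r * t `^ alpha))) +
      2 * (t `^ (n%:R + alpha) * expR (- (cos r * t `^ alpha))).
    have s0 : 0 <= n.+1%:R / alpha by rewrite divr_ge0// ltW.
    by apply: addr_ge0; apply: mulr_ge0 => //; apply: mulr_ge0;
       rewrite ?powR_ge0 ?expR_ge0.
  have GK x t : `]-r, r[%classic x -> `]0, +oo[%classic t ->
      `|partial1of2 K x t| <=
      n.+1%:R / alpha * (t `^ n%:R * expR (- (cos r * t `^ alpha))) +
      2 * (t `^ (n%:R + alpha) * expR (- (cos r * t `^ alpha))).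
    move=> /= xr; rewrite in_itv/= andbT => t0.
    by rewrite dK; apply: rotated_rate_le => //; exact: cos_ge.
  have iG := integrable_rate_bound n al0 cr.
  apply: DeriveDef.

    exact: (@derivable_under_integral R _ _ mu K _ (measurable_itv _)
      _ _ _ psir' iK derK _ G0 iG GK).
  rewrite -derive1E (@differentiation_under_integral R _ _ mu K _
    (measurable_itv _) _ _ _ psir' iK derK _ G0 iG GK).
  under eq_Rintegral do rewrite dK.
  by rewrite Rintegral_rotated_rate// (lt_le_trans cr)// cos_ge.
have FF : F psi0 = F 0.
  apply: (is_derive_0_itv_cst dF).
    by rewrite in_itv/= -ltr_norml.
  by rewrite in_itv/= oppr_lt0 (le_lt_trans _ r1)//=.
transitivity (F psi0).
  by rewrite /F /K /d addrK.
(* At angle 0 the oscillation in [t] disappears and only the constant factor [cos d] is left. *)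
rewrite FF /F -RintegralZl//.
  apply: eq_Rintegral => t _; rewrite /K /rotated.
  by rewrite cos0 sin0 !mulr0 subr0 add0r mulr1 -/d mulrC.
exact: integrable_expn_stretched1.
Qed.
End rotation.

(** * The gamma function *)

Section gamma.
Context {R : realType}.
Local Notation mu := (@lebesgue_measure R).
Implicit Types (f g : R -> R) (a alpha t : R).

Lemma integrable_mull (c : R) f :
  mu.-integrable `]0, +oo[ (EFin \o f) ->
  mu.-integrable `]0, +oo[ (EFin \o (fun t => c * f t)).
Proof.
move=> If; rewrite (_ : _ \o _ = (fun t : R => c%:E * (f t)%:E)%E).
  exact: (@integrableZl _ _ _ mu _ (measurable_itv _) c (EFin \o f)).
by apply/funext => t /=; rewrite EFinM.
Qed.

(** Monotone convergence. The endpoints are arbitrary because a change of variable sends the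
    intervals [[1/k, k]] to intervals of another shape. *)
Lemma ge0_integral_exhaust f (c d : nat -> R) : {in `]0, +oo[, continuous f} ->
  (forall u, 0 < u -> 0 <= f u) ->
  (forall k, 0 < c k) -> {homo c : k l / (k <= l)%N >-> l <= k} ->
  {homo d : k l / (k <= l)%N >-> k <= l} ->
  (forall t, 0 < t -> exists k, c k <= t <= d k) ->
  (\int[mu]_(x in `[c k, d k]) (f x)%:E)%E @[k --> \oo] -->
  (\int[mu]_(x in `]0%R, +oo[) (f x)%:E)%E.
Proof.
move=> cf f0 c0 ndc ndd ex.
have bigcupE : `]0, +oo[%classic = \bigcup_k `[c k, d k]%classic.
  apply/seteqP; split=> [t/=|t [k _]/=]; rewrite !in_itv/= ?andbT.
    by move=> /ex[k ctd]; exists k => //=; rewrite in_itv.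
  by move=> /andP[ct _]; exact: lt_le_trans ct.
have sub k : `[c k, d k]%classic `<=` (`]0, +oo[%classic : set R).
  by move=> t ht; rewrite bigcupE; exists k.
rewrite bigcupE.
have := @ge0_nondecreasing_set_cvg_integral _ (measurableTypeR R) R
  (fun k => `[c k, d k]%classic) (EFin \o f) mu.
apply.
- move=> k l kl; apply/subsetPset => t/=; rewrite !in_itv/= => /andP[ct td].
  by rewrite (le_trans _ ct) ?ndc// (le_trans td)// ndd.
- by move=> k; exact: measurable_itv.
- move=> k; apply/measurable_EFinP.
  by apply: measurable_funS (sub k) (continuous_oy_measurable cf).
- by move=> k t /sub/=; rewrite in_itv/= andbT => t0; rewrite lee_fin f0.
Qed.

(** The substitution [u = t^alpha] is made on compact intervals; both sides are then limits of one
    and the same sequence of integrals. *)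
Lemma ge0_integral_powR_subst g alpha : 0 < alpha ->
  {in `]0, +oo[, continuous g} -> (forall u, 0 < u -> 0 <= g u) ->
  (\int[mu]_(u in `]0%R, +oo[) (g u)%:E =
   \int[mu]_(t in `]0%R, +oo[) (g (t `^ alpha) * (alpha * t `^ (alpha - 1)))%:E)%E.
Proof.
move=> al0 cg g0.
pose P t : R := t `^ alpha.
pose h t : R := g (P t) * (alpha * t `^ (alpha - 1)).
pose b (k : nat) : R := k.+1%:R.
have b1 k : 1 <= b k by rewrite ler1n.
have b0 k : 0 < b k by rewrite ltr0n.
have bV0 k : 0 < (b k)^-1 by rewrite invr_gt0.
have bb k : (b k)^-1 <= b k by rewrite (le_trans _ (b1 k)) ?invf_le1.
have P0 t : 0 < t -> 0 < P t by exact: powR_gt0.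
have Pmono s t : 0 < s -> s <= t -> P s <= P t.
  move=> s0 st; apply: ge0_ler_powR => //; rewrite ?nnegrE ?ltW//.
  exact: lt_le_trans st.
have dP t : 0 < t -> is_derive t 1 P (alpha * t `^ (alpha - 1)).
  by move=> t0; exact: is_derive1_powR.
have cP t : 0 < t -> {for t, continuous P}.
  by move=> t0; exact: is_derive_continuous (dP t t0).
have cP' t : 0 < t -> {for t, continuous (fun t => alpha * t `^ (alpha - 1))}.
  by move=> t0; apply: cvgMr; exact: is_derive_continuous (is_derive1_powR _ t0).
have P'E t : 0 < t -> derive1 P t = alpha * t `^ (alpha - 1).
  by move=> t0; rewrite derive1E; have [_ ->] := dP t t0.
have P'cvg t : 0 < t -> derive1 P x @[x --> t] --> alpha * t `^ (alpha - 1).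
  move=> t0; apply: cvg_trans (cP' t t0); apply: near_eq_cvg.
  by near=> x; rewrite P'E//; near: x; exact: lt_nbhsr.
have ch : {in `]0, +oo[, continuous h}.
  move=> t; rewrite in_itv/= andbT => t0; apply: cvgM; last exact: cP'.
  by apply: (continuous_comp (cP _ t0)); apply: cg; rewrite in_itv/= andbT P0.
have h0 t : 0 < t -> 0 <= h t.
  by move=> t0; rewrite mulr_ge0 ?g0 ?P0// mulr_ge0 ?powR_ge0// ltW.
have H k : (\int[mu]_(u in `[P (b k)^-1%R, P (b k)]) (g u)%:E =
            \int[mu]_(t in `[(b k)^-1%R, b k]) (h t)%:E)%E.
  have pos t : (b k)^-1 <= t -> 0 < t by exact: lt_le_trans.
  rewrite integration_by_substitution_increasing//.
  - apply: eq_integral => t; rewrite inE/= in_itv/= => /andP[/pos t0 _].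
    by rewrite fctE P'E.
  - move=> s t; rewrite !in_itv/= => /andP[/pos s0 _] /andP[/pos t0 _].
    by apply: gt0_ltr_powR => //; rewrite nnegrE ltW.
  - move=> t; rewrite in_itv/= => /andP[/ltW/pos t0 _].
    by rewrite /continuous_at P'E//; exact: P'cvg.
  - by apply: cvgP; apply: cvg_at_right_filter; exact: P'cvg.
  - by apply: cvgP; apply: cvg_at_left_filter; exact: P'cvg.
  - split.
    + by move=> t; rewrite in_itv/= => /andP[/ltW/pos t0 _]; have [] := dP t t0.
    + by apply: cvg_at_right_filter; exact: cP.
    + by apply: cvg_at_left_filter; exact: cP.
  - apply: continuous_in_subspaceT => u /[!inE]/=; rewrite in_itv/= => /andP[Pu _].
    by apply: cg; rewrite in_itv/= andbT (lt_le_trans _ Pu)// P0.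
have bmono : {homo b : k l / (k <= l)%N >-> k <= l}.
  by move=> k l kl; rewrite ler_nat.
have bVmono : {homo (fun k => (b k)^-1) : k l / (k <= l)%N >-> l <= k}.
  by move=> k l kl; rewrite lef_pV2 ?posrE ?bmono.
have bex t : 0 < t -> exists k, (b k)^-1 <= t <= b k.
  move=> t0; exists (Num.truncn (Num.max t t^-1)).
  have m0 : 0 <= Num.max t t^-1 by rewrite le_max ltW.
  have := truncnS_gt (Num.max t t^-1); rewrite gt_max => /andP[tm tVm].
  rewrite (ltW tm) andbT -[leRHS]invrK lef_pV2 ?posrE ?invr_gt0//.
  exact: ltW.
have := ge0_integral_exhaust ch h0 bV0 bVmono bmono bex.
under eq_fun do rewrite -H.
move=> H1.
have H2 := @ge0_integral_exhaust g (fun k => P (b k)^-1) (fun k => P (b k)) cg g0.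
have {}H2 := H2 (fun k => P0 _ (bV0 k)).
apply: (cvg_unique _ (H2 _ _ _) H1) => //.
- by move=> k l kl; apply: Pmono => //; exact: bVmono.
- by move=> k l kl; apply: Pmono => //; exact: bmono.
(* The image intervals also exhaust the half line: the preimage [t^(1/alpha)] lies in some original
   interval. *)
- move=> t t0; have [k /andP[bk kb]] := bex (t `^ alpha^-1) (powR_gt0 _ t0).
  exists k; have <- : P (t `^ alpha^-1) = t.
    by rewrite /P -powRrM mulVf ?gt_eqF// powRr1// ltW.
  by rewrite !Pmono ?powR_gt0.
Unshelve. all: end_near. Qed.

(** The substitution [u = t^alpha] in Euler's integral at [s = (n + 1) / alpha]: the power becomes
    [t^(alpha (s - 1)) t^(alpha - 1) = t^n], and the Jacobian leaves a factor [alpha]. *)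
Lemma Rintegral_Gamma alpha n : 0 < alpha ->
  \int[mu]_(t in `]0, +oo[) (t ^+ n * expR (- t `^ alpha)) =
  alpha^-1 * Gamma (n.+1%:R / alpha).
Proof.
move=> al0.
have cg : {in `]0, +oo[, continuous
    (fun u : R => u `^ (n.+1%:R / alpha - 1) * expR (- u))}.
  move=> u; rewrite in_itv/= andbT => u0.
  have du := is_derive1_powR (n.+1%:R / alpha - 1) u0.
  by apply: is_derive_continuous.
have g0 (u : R) : 0 < u -> 0 <= u `^ (n.+1%:R / alpha - 1) * expR (- u).
  by move=> u0; rewrite mulr_ge0 ?powR_ge0 ?expR_ge0.
rewrite /Gamma /Rintegral (ge0_integral_powR_subst al0 cg g0).
have I := integrable_expn_stretched1 n al0.
rewrite [in RHS](@eq_integral _ _ _ mu _ (fun t : R =>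
  alpha%:E * (t ^+ n * expR (- t `^ alpha))%:E)%E).
  rewrite integralZl//.
  rewrite fineM//; last exact: integrable_fin_num.
  by rewrite mulrA mulVf ?gt_eqF// mul1r.
move=> t; rewrite inE/= in_itv/= andbT => t0.
rewrite -EFinM; congr EFin.
have -> : (t `^ alpha) `^ (n.+1%:R / alpha - 1) = t ^+ n / t `^ (alpha - 1).
  rewrite -powRrM -(powR_mulrn n (ltW t0)) -powRB; last by rewrite (gt_eqF t0) implybT.
  congr (_ `^ _); rewrite -natr1; field; exact: lt0r_neq0.
have := powR_gt0 (alpha - 1) t0.
by move: (_ `^ (alpha - 1)) => y y0; field; rewrite gt_eqF.
Qed.

(** Integration by parts, written as the vanishing of the integral of the derivative of
    [t^(n+1) exp(- a t)]. These moments serve for comparison when [alpha] is not 1. *)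
Lemma Rintegral_expn_expR n a : 0 < a ->
  \int[mu]_(t in `]0, +oo[) (t ^+ n * expR (- (a * t))) = n`!%:R / a ^+ n.+1.
Proof.
move=> a0; have aN0 : a != 0 by rewrite gt_eqF.
pose f m t : R := t ^+ m * expR (- (a * t)).
have cf m : {in `]0, +oo[, continuous (f m)}.
  by move=> t _; apply: is_derive_continuous.
have If m : mu.-integrable `]0, +oo[ (EFin \o f m).
  apply: (integrable_stretched (p := m%:R) (K := 1) (cf m) _ a0 ltr01) => //.
  move=> t t0; rewrite (powR_mulrn m (ltW t0)) powRr1 ?(ltW t0)// mul1r.
  by rewrite ger0_norm// mulr_ge0 ?expR_ge0// exprn_ge0// ltW.
have f0y m : f m t @[t --> +oo] --> 0.
  apply: cvg_trans (stretched_cvgy (ler0n _ m) a0 ltr01); apply: near_eq_cvg.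
  by near=> t; rewrite /f powR_mulrn ?powRr1//.
have f00 m : f m t @[t --> 0^'+] --> f m 0.
  by apply: cvg_at_right_filter; apply: is_derive_continuous.
elim: n => [|n IH].
  have cg : {in `]0, +oo[, continuous (fun t => - a * f 0 t)}.
    by move=> t _; apply: is_derive_continuous.
  have Ig : mu.-integrable `]0, +oo[ (EFin \o (fun t => - a * f 0 t)).
    exact: integrable_mull.
  have df t : 0 < t -> is_derive t 1 (f 0) (- a * f 0 t).
    by move=> t0; rewrite /f; apply: is_derive_eq; rewrite /GRing.scale/=; ring.
  have := Rintegral_oy_FTC Ig cg df (f00 0) (f0y 0).
  rewrite RintegralZl//.
  (* Only the exponent 0 has a nonzero boundary term at the origin. *)
  have -> : f 0 0 = 1 by rewrite /f expr0 mulr0 oppr0 expR0 mulr1.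
  rewrite sub0r mulNr => /oppr_inj H.
  by rewrite fact0 expr1 div1r; apply: (mulfI aN0); rewrite mulfV.
have cg : {in `]0, +oo[, continuous (fun t => n.+1%:R * f n t - a * f n.+1 t)}.
  by move=> t _; apply: is_derive_continuous.
have I1 : mu.-integrable `]0, +oo[ (EFin \o (fun t => n.+1%:R * f n t)).
  exact: integrable_mull.
have I2 : mu.-integrable `]0, +oo[ (EFin \o (fun t => a * f n.+1 t)).
  exact: integrable_mull.
have Ig : mu.-integrable `]0, +oo[
    (EFin \o (fun t => n.+1%:R * f n t - a * f n.+1 t)).
  by apply: (integrableB _ I1 I2).
have df t : 0 < t -> is_derive t 1 (f n.+1) (n.+1%:R * f n t - a * f n.+1 t).
  by move=> t0; rewrite /f; apply: is_derive_eq; rewrite /GRing.scale/=; ring.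
have := Rintegral_oy_FTC Ig cg df (f00 n.+1) (f0y n.+1).
have -> : f n.+1 0 = 0 by rewrite /f expr0n/= mul0r.
rewrite RintegralB// !RintegralZl// subr0 => /eqP; rewrite subr_eq0 => /eqP H.
apply: (mulfI aN0); rewrite -H IH factS natrM [in RHS]exprS invfM.
have := expf_neq0 n.+1 aN0; move: (a ^+ n.+1) => y y0.
by field; rewrite aN0 y0.
Unshelve. all: end_near. Qed.

Lemma Gamma_nat n : Gamma (n.+1%:R : R) = n`!%:R.
Proof.
have := Rintegral_Gamma n (@ltr01 R); rewrite invr1 mul1r mulr1 => <-.
transitivity (\int[mu]_(t in `]0, +oo[) (t ^+ n * expR (- (1 * t)))).
  apply: eq_Rintegral => t; rewrite inE/= in_itv/= andbT => t0.
  by rewrite powRr1 ?mul1r// ltW.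
by rewrite Rintegral_expn_expR// expr1n divr1.
Qed.
End gamma.

(** * Taylor expansion of the Fourier integral *)

Section taylor.
Context {R : realType}.
Local Notation mu := (@lebesgue_measure R).
Implicit Types (g : R -> R) (B x y alpha t psi : R).

(** The Taylor polynomial with [N] terms, at [y = 0], of [cos (B - y)]: each derivative in [y]
    shifts the argument by [- pi / 2]. *)
Definition cos_taylor N B y : R :=
  \sum_(0 <= n < N) (y ^+ n / n`!%:R * cos (B - n%:R * (pi / 2))).

Lemma is_derive_cos_taylor N B y :
  is_derive y 1 (cos_taylor N.+1 B) (cos_taylor N (B - pi / 2) y).
Proof.
elim: N => [|N IH].
  rewrite /cos_taylor big_nil (_ : (fun _ => _) = fun=> cos (B - 0 * (pi / 2))).
    exact: is_derive_cst_fun.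
  by apply/funext => z; rewrite big_nat1 expr0 fact0 divr1 mul1r.
rewrite {1}/cos_taylor; under eq_fun do rewrite big_nat_recr//=.
rewrite /cos_taylor big_nat_recr//=; apply: is_deriveD_fun => //.
apply: is_derive_eq; rewrite /GRing.scale/= factS natrM.
have -> : B - pi / 2 - N%:R * (pi / 2) = B - N.+1%:R * (pi / 2).
  by rewrite -natr1; ring.
have f0 : N`!%:R != 0 :> R by rewrite pnatr_eq0 -lt0n fact_gt0.
have s0 : N.+1%:R != 0 :> R by rewrite pnatr_eq0.
by move: (N.+1%:R) s0 => s s0; field; rewrite s0 f0.
Qed.

Lemma derive_ge0_le g (dg : R -> R) y : 0 <= y ->
  (forall z : R, is_derive z 1 g (dg z)) ->
  (forall z, 0 <= z -> 0 <= dg z) -> g 0 <= g y.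
Proof.
move=> y0 dgP dg0.
have cg : {within `[0, y], continuous g}.
  by apply: continuous_in_subspaceT => z _; exact: is_derive_continuous (dgP z).
have [c] := @MVT_segment R g dg 0 y y0 (fun z _ => dgP z) cg.
rewrite in_itv/= => /andP[c0 _] gE.
by rewrite -subr_ge0 gE mulr_ge0 ?dg0// subr0.
Qed.

(** Induction on [N] with [B] free, since differentiating the remainder lowers its order and turns
    [B] into [B - pi / 2]. The bound plus or minus the remainder vanishes at 0 and has nonnegative
    derivative. *)
Lemma cos_taylor_le_ge0 N B y : 0 <= y ->
  `|cos (B - y) - cos_taylor N B y| <= y ^+ N / N`!%:R.
Proof.
elim: N B y => [|N IH] B y y0.
  by rewrite /cos_taylor big_nil subr0 expr0 fact0 divr1 cos_max.
pose f z := cos (B - z) - cos_taylor N.+1 B z.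
pose df z := cos (B - pi / 2 - z) - cos_taylor N (B - pi / 2) z.
have fP (z : R) : is_derive z 1 f (df z).
  apply: is_deriveD_fun; last exact/is_deriveN_fun/is_derive_cos_taylor.
  apply: is_derive_eq; rewrite addrAC cosBpihalf; ring.
have f0 : f 0 = 0.
  rewrite /f /cos_taylor subr0 big_nat_recl//= big1_seq; last first.
    by move=> i _; rewrite exprS !mul0r.
  by rewrite expr0 fact0 divr1 !mul1r mul0r subr0 addr0 subrr.
have fact0N : N`!%:R != 0 :> R by rewrite pnatr_eq0 -lt0n fact_gt0.
have gP (z : R) : is_derive z 1 (fun z : R => z ^+ N.+1 / N.+1`!%:R) (z ^+ N / N`!%:R).
  apply: is_derive_eq; rewrite /GRing.scale/= factS natrM.
  have s0 : N.+1%:R != 0 :> R by rewrite pnatr_eq0.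
  by move: (N.+1%:R) s0 => s s0; field; rewrite s0 fact0N.
have dfle z : 0 <= z -> `|df z| <= z ^+ N / N`!%:R by exact: IH.
rewrite ler_norml; apply/andP; split.
  have := @derive_ge0_le (fun z => z ^+ N.+1 / N.+1`!%:R + f z)
    (fun z => z ^+ N / N`!%:R + df z) y y0.
  rewrite f0 expr0n/= mul0r addr0 => H.
  rewrite lerNl -subr_ge0 opprK; apply: H.
  move=> z z0; have := dfle z z0; rewrite ler_norml => /andP[+ _].
  by rewrite -subr_ge0 opprK addrC.
have := @derive_ge0_le (fun z => z ^+ N.+1 / N.+1`!%:R - f z)
  (fun z => z ^+ N / N`!%:R - df z) y y0.
rewrite f0 expr0n/= mul0r subr0 => H.
rewrite -subr_ge0; apply: H.
by move=> z z0; have := dfle z z0; rewrite ler_norml subr_ge0 => /andP[_].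
Qed.

(** Passing to the opposite arguments shifts the [n]-th angle by [n pi], whose sign cancels that of
    [(- y)^n]. *)
Lemma cos_taylorN N B y : cos_taylor N (- B) (- y) = cos_taylor N B y.
Proof.
apply: eq_bigr => n _; rewrite exprNn.
have -> : - B - n%:R * (pi / 2) = - ((B - n%:R * (pi / 2)) + pi *+ n).
  by rewrite -mulr_natr; field.
rewrite cosN (alternatingn (@cosDpi R)).
by rewrite mulrA mulrAC -!mulrA -signr_odd; case: (odd n); rewrite ?expr1 ?expr0; ring.
Qed.

Lemma cos_taylor_le N B y :
  `|cos (B - y) - cos_taylor N B y| <= `|y| ^+ N / N`!%:R.
Proof.
have [y0|/ltW y0] := leP 0 y.
  by rewrite (ger0_norm y0); exact: cos_taylor_le_ge0.
have -> : cos (B - y) = cos (- B - - y) by rewrite -cosN opprB opprK addrC.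
by rewrite (ler0_norm y0) -cos_taylorN cos_taylor_le_ge0// oppr_ge0.
Qed.

Definition half_line_fourier alpha psi x : R :=
  \int[mu]_(t in `]0, +oo[)
    (expR (- (t `^ alpha * cos psi)) * cos (t `^ alpha * sin psi - t * x)).

Lemma integrable_fourier alpha psi x : 0 < alpha -> 0 < cos psi ->
  mu.-integrable `]0, +oo[ (EFin \o (fun t =>
    expR (- (t `^ alpha * cos psi)) * cos (t `^ alpha * sin psi - t * x))).
Proof.
move=> al0 c0; apply: (integrable_stretched (p := 0) (K := 1) _ _ c0 al0) => //.
  move=> t; rewrite in_itv/= andbT => t0.
  have dt := is_derive1_powR alpha t0.
  by apply: is_derive_continuous.
move=> t t0; rewrite powRr0 !mul1r normrM (ger0_norm (expR_ge0 _)) mulrC.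
by rewrite [in leRHS]mulrC -[leRHS]mul1r ler_wpM2r ?expR_ge0 ?cos_max.
Qed.

(** Integrability and value go through one induction, because linearity at each step needs the
    integrability of the previous sum. The term of rank [n] is a rotated moment with phase
    [- n pi / 2]. *)
Lemma integral_cos_taylor alpha psi x N : 0 < alpha -> `|psi| < pi / 2 ->
  mu.-integrable `]0, +oo[ (EFin \o (fun t =>
    expR (- (t `^ alpha * cos psi)) * cos_taylor N (t `^ alpha * sin psi) (t * x))) /\
  \int[mu]_(t in `]0, +oo[) (expR (- (t `^ alpha * cos psi)) *
     cos_taylor N (t `^ alpha * sin psi) (t * x)) =
  alpha^-1 * \sum_(0 <= n < N) (x ^+ n / n`!%:R * Gamma (n.+1%:R / alpha) *
     cos (n.+1%:R / alpha * psi - n%:R * (pi / 2))).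
Proof.
move=> al0 psipi.
have c0 : 0 < cos psi by rewrite cos_gt0_pihalf// -ltr_norml.
elim: N => [|N [IH1 IH2]].
  rewrite big_nil mulr0 (_ : (fun _ => _) = fun=> 0).
    by split; [exact: integrable0|rewrite Rintegral_cst// mul0r].
  by apply/funext => t; rewrite /cos_taylor big_nil mulr0.
have E : (fun t => expR (- (t `^ alpha * cos psi)) *
    cos_taylor N.+1 (t `^ alpha * sin psi) (t * x)) =
  (fun t => expR (- (t `^ alpha * cos psi)) *
    cos_taylor N (t `^ alpha * sin psi) (t * x) +
    x ^+ N / N`!%:R * rotated alpha (- (N%:R * (pi / 2))) N psi t).
  apply/funext => t; rewrite /cos_taylor big_nat_recr//= mulrDr /rotated exprMn.
  by congr (_ + _); ring.
have I2 := integrable_mull (x ^+ N / N`!%:R)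
  (rotated_integrable (- (N%:R * (pi / 2))) N al0 c0).
rewrite E; split; first exact: (integrableD _ IH1 I2).
rewrite RintegralD// IH2 RintegralZl//; last exact: rotated_integrable.
rewrite Rintegral_rotated// Rintegral_Gamma// big_nat_recr//= mulrDr; congr (_ + _).
by rewrite (addrC (- _)); ring.
Qed.

(** The damping exponential is kept exact and only the cosine is expanded, so its pointwise Taylor
    error is integrated against the exponential. *)
Lemma fourier_remainder_le alpha psi x N : 0 < alpha -> `|psi| < pi / 2 ->
  `|half_line_fourier alpha psi x -
    alpha^-1 * \sum_(0 <= n < N) (x ^+ n / n`!%:R * Gamma (n.+1%:R / alpha) *
     cos (n.+1%:R / alpha * psi - n%:R * (pi / 2)))| <=
  `|x| ^+ N / N`!%:R *
  \int[mu]_(t in `]0, +oo[) (t ^+ N * expR (- (cos psi * t `^ alpha))).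
Proof.
move=> al0 psipi.
have c0 : 0 < cos psi by rewrite cos_gt0_pihalf// -ltr_norml.
have [I2 <-] := integral_cos_taylor x N al0 psipi.
have I1 := integrable_fourier x al0 c0.
have I3 : mu.-integrable `]0, +oo[ (EFin \o (fun t =>
    `|x| ^+ N / N`!%:R * (t ^+ N * expR (- (cos psi * t `^ alpha))))).
  by apply: integrable_mull; exact: integrable_expn_stretched.
rewrite -RintegralB// -RintegralZl//; last exact: integrable_expn_stretched.
have IB := @integrableB _ _ _ mu _ (measurable_itv _) _ _ I1 I2.
rewrite (le_trans (le_normr_Rintegral _ IB))//.
apply: le_Rintegral => //; first exact: integrable_norm.
move=> t; rewrite /= in_itv/= andbT => t0.
rewrite -mulrBr normrM (ger0_norm (expR_ge0 _)).
rewrite (mulrC (cos psi)) mulrA [leRHS]mulrC ler_wpM2l ?expR_ge0//.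
rewrite (le_trans (cos_taylor_le _ _ _))// normrM exprMn (gtr0_norm t0).
by rewrite le_eqVlt; apply/orP; left; apply/eqP; ring.
Qed.
End taylor.

(** * Fourier inversion *)

Section inversion.
Context {R : realType}.
Local Notation mu := (@lebesgue_measure R).
Implicit Types (f : R -> R) (x alpha t : R).

Lemma ge0_integralT_fold (f : R -> \bar R) :
  measurable_fun [set: R] f -> (forall t, 0 <= f t)%E ->
  (\int[mu]_t f t =
   \int[mu]_(t in `]0%R, +oo[) f t + \int[mu]_(t in `]0%R, +oo[) f (- t)%R)%E.
Proof.
move=> mf f0.
have mfN : measurable_fun [set: R] (fun t => f (- t)).
  by apply: (measurableT_comp mf); exact: oppr_measurable.
have H : (\int[mu]_(t in `]0%R, +oo[) f (- t)%R = \int[mu]_(t in `]-oo, 0%R]) f t)%E.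
  rewrite integral_itv_obnd_cbnd; last exact: measurable_funTS.
  rewrite (ge0_integration_by_substitution0 mfN)//.
  by apply: eq_integral => t _; rewrite opprK.
rewrite H -ge0_integral_setU//=; last 2 first.
- exact: measurable_funTS.
- rewrite disj_set2E; apply/eqP/seteqP; split => // t [/=].
  by rewrite !in_itv/= andbT => t0; rewrite leNgt t0.
congr integral; apply/seteqP; split => // t _ /=; rewrite !in_itv/= andbT.
by case: (ltP 0 t) => _; [left|right].
Qed.

Lemma Rintegral_even f : measurable_fun [set: R] f ->
  mu.-integrable `]0, +oo[ (EFin \o f) -> (forall t, f (- t) = f t) ->
  \int[mu]_t f t = 2 * \int[mu]_(t in `]0, +oo[) f t.
Proof.
move=> mf If fN.
have mfE : measurable_fun [set: R] (EFin \o f) by exact/measurable_EFinP.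
have Ip := @integrable_funepos _ _ _ mu _ (measurable_itv _) _ If.
have In := @integrable_funeneg _ _ _ mu _ (measurable_itv _) _ If.
rewrite /Rintegral integralE !ge0_integralT_fold//; last 2 first.
- exact: measurable_funeneg.
- exact: measurable_funepos.
rewrite [in RHS]integralE.
have Np t : ((EFin \o f)^\+ (- t)%R = (EFin \o f)^\+ t)%E by rewrite !funeposE/= fN.
have Nn t : ((EFin \o f)^\- (- t)%R = (EFin \o f)^\- t)%E by rewrite !funenegE/= fN.
under [X in (_ + X - _)%E]eq_integral do rewrite Np.
under [X in (_ - (_ + X))%E]eq_integral do rewrite Nn.
have Fp := @integrable_fin_num _ _ _ mu _ (measurable_itv _) _ Ip.
have Fn := @integrable_fin_num _ _ _ mu _ (measurable_itv _) _ In.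
rewrite -(fineK Fp) -(fineK Fn) /=.
by ring.
Qed.

(** Reflection exchanges the positive and negative parts of [f], so their integrals over the line
    coincide. *)
Lemma Rintegral_odd f : measurable_fun [set: R] f ->
  (forall t, f (- t) = - f t) -> \int[mu]_t f t = 0.
Proof.
move=> mf fN.
have mfE : measurable_fun [set: R] (EFin \o f) by exact/measurable_EFinP.
rewrite /Rintegral integralE !ge0_integralT_fold//; last 2 first.
- exact: measurable_funeneg.
- exact: measurable_funepos.
have Np t : ((EFin \o f)^\+ (- t)%R = (EFin \o f)^\- t)%E.
  by rewrite funeposE funenegE/= fN.
have Nn t : ((EFin \o f)^\- (- t)%R = (EFin \o f)^\+ t)%E.
  by rewrite funeposE funenegE/= fN opprK.
under [X in (_ + X - _)%E]eq_integral do rewrite Np.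
under [X in (_ - (_ + X))%E]eq_integral do rewrite Nn.
rewrite [X in (_ - X)%E]addeC.
(* If the common value is infinite, the difference is an infinite extended real, which [fine] sends
   to 0. *)
by case: (X in (X - X)%E) => [r| |] //=; rewrite subrr.
Qed.

(** Writing the integrand through [|t|] and the sign of [t] makes its real part visibly even and its
    imaginary part visibly odd. *)
Lemma stable_integrandE x alpha theta t : 0 < alpha ->
  let psi := pi / 2 * alpha * theta in
  cexp (- ('i * (t * x)%:C)) * stable_charfun t alpha theta =
  (expR (- (`|t| `^ alpha * cos psi)) * cos (`|t| `^ alpha * sin psi - `|t| * x)) +i*
  (expR (- (`|t| `^ alpha * cos psi)) *
     (Num.sg t * sin (`|t| `^ alpha * sin psi - `|t| * x))).
Proof.
move=> al0 psi.
have iE y : - ('i * y%:C) = 0 +i* (- y) :> R[i].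
  by apply/eqP; rewrite eq_complex/= !(mul0r, mul1r, mulr0, subr0, add0r, oppr0) !eqxx.
have cE (a b : R) : cexp (a +i* b) = (expR a * cos b) +i* (expR a * sin b).
  by apply/eqP; rewrite eq_complex/= !mul0r subr0 addr0 !eqxx.
have c0E y : cexp (0 +i* - y) = cos y +i* - sin y :> R[i].
  by rewrite cE expR0 !mul1r cosN sinN.
have prodE (u v E : R) : (cos u +i* - sin u) * ((E * cos v) +i* (E * sin v)) =
    (E * cos (v - u)) +i* (E * sin (v - u)).
  by apply/eqP; rewrite eq_complex/= cosB sinB; apply/andP; split; apply/eqP; ring.
have scaleE (r u v : R) : - (r%:C * (u +i* - v)) = (- (r * u)) +i* (r * v).
  by apply/eqP; rewrite eq_complex/= !(mul0r, mulrN, opprK, subr0, addr0, oppr0) !eqxx.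
rewrite /stable_charfun !iE !c0E scaleE cE prodE -/psi.
have [t0|t0|<-] := ltgtP 0 t.
- by rewrite (gtr0_norm t0) (gtr0_sg t0) mulr1 mul1r.
- rewrite (ltr0_norm t0) (ltr0_sg t0) mulrN1 cosN sinN mulN1r.
  have -> : (- t) `^ alpha * - sin psi - t * x = - ((- t) `^ alpha * sin psi - - t * x).
    by ring.
  by rewrite cosN sinN.
- by rewrite normr0 powR0 ?gt_eqF// sgr0 !mul0r subr0 sin0 !mulr0.
Qed.

Lemma measurable_sgr : measurable_fun [set: R] (Num.sg : R -> R).
Proof.
apply: measurable_fun_ifT => //; first exact: measurable_fun_eqr.
by apply: measurable_fun_ifT => //; exact: measurable_fun_ltr.
Qed.

(** Parity kills the imaginary part and doubles the real one, which turns [1 / (2 pi)] into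
    [1 / pi]. *)
Lemma stable_density_half_line x alpha theta : 0 < alpha ->
  0 < cos (pi / 2 * alpha * theta) ->
  stable_density x alpha theta =
  (pi^-1 * half_line_fourier alpha (pi / 2 * alpha * theta) x)%:C.
Proof.
move=> al0 c0; rewrite /stable_density /cintegral.
set psi := pi / 2 * alpha * theta.
pose e t : R := expR (- (`|t| `^ alpha * cos psi)).
pose w t : R := `|t| `^ alpha * sin psi - `|t| * x.
have mabs : measurable_fun [set: R] (fun t : R => `|t|) by exact: normr_measurable.
have mpow : measurable_fun [set: R] (fun t : R => `|t| `^ alpha).
  exact: (measurableT_comp (@measurable_powR R alpha) mabs).
have me : measurable_fun [set: R] e.
  apply: measurableT_comp; first exact: measurable_expR.
  by apply: measurableT_comp => //; exact: measurable_funM.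
have mw : measurable_fun [set: R] w.
  by apply: measurable_funB; exact: measurable_funM.
have mcos : measurable_fun [set: R] (@cos R).
  by apply: continuous_measurable_fun; exact: continuous_cos.
have msin : measurable_fun [set: R] (@sin R).
  by apply: continuous_measurable_fun; exact: continuous_sin.
have wN t : w (- t) = w t by rewrite /w normrN.
have eN t : e (- t) = e t by rewrite /e normrN.
under [X in X +i* _]eq_Rintegral do rewrite stable_integrandE//=.
under [X in _ +i* X]eq_Rintegral do rewrite stable_integrandE//=.
rewrite -/psi (Rintegral_odd (f := fun t => e t * (Num.sg t * sin (w t)))); last 2 first.
- apply: measurable_funM => //; apply: measurable_funM; first exact: measurable_sgr.
  exact: measurableT_comp.
- by move=> t; rewrite eN wN sgrN mulNr mulrN.
have E t : t \in (`]0, +oo[%classic : set R) -> e t * cos (w t) =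
    expR (- (t `^ alpha * cos psi)) * cos (t `^ alpha * sin psi - t * x).
  by rewrite inE/= in_itv/= andbT => t0; rewrite /e /w gtr0_norm.
rewrite (Rintegral_even (f := fun t => e t * cos (w t))); last 3 first.
- by apply: measurable_funM => //; exact: measurableT_comp.
- apply: eq_integrable (integrable_fourier x al0 c0) => // t tP /=.
  by rewrite E.
- by move=> t; rewrite eN wN.
have -> : \int[mu]_(t in `]0, +oo[) (e t * cos (w t)) = half_line_fourier alpha psi x.
  by apply: eq_Rintegral => t; exact: E.
apply/eqP; rewrite eq_complex/= !(mul0r, mulr0, subr0, addr0) eqxx andbT.
apply/eqP; have pi0 : pi != 0 :> R by rewrite gt_eqF// pi_gt0.
by rewrite invfM mulrACA mulVf ?mul1r// pnatr_eq0.
Qed.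
End inversion.

(** * Error bounds and the three cases *)

Section expansion.
Context {R : realType}.
Local Notation mu := (@lebesgue_measure R).
Implicit Types (a p q x alpha theta t : R).

Lemma admissible_angle alpha theta : 0 < alpha -> alpha * `|theta| < 1 ->
  `|pi / 2 * alpha * theta| < pi / 2.
Proof.
move=> al0 h; rewrite !normrM (gtr0_norm al0) -mulrA gtr0_norm ?pi_gt0//.
by rewrite (@gtr0_norm _ 2^-1) ?invr_gt0// gtr_pMr// divr_gt0// pi_gt0.
Qed.

(** The angle of the sine, lowered by [pi / 2], is the opposite of the angle of the cosine produced
    by the Taylor expansion. *)
Lemma stable_partial_sumE N x alpha theta : 0 < alpha ->
  stable_partial_sum N x alpha theta =
  pi^-1 * (alpha^-1 * \sum_(0 <= n < N) (x ^+ n / n`!%:R * Gamma (n.+1%:R / alpha) *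
     cos (n.+1%:R / alpha * (pi / 2 * alpha * theta) - n%:R * (pi / 2)))).
Proof.
move=> al0; rewrite /stable_partial_sum invfM mulrA (mulrC pi^-1); congr (_ * _).
apply: eq_bigr => n _; congr (_ * _).
rewrite -[LHS]cosBpihalf -cosN; congr cos; rewrite -natr1.
by field; rewrite gt_eqF.
Qed.

Lemma stable_density_remainder N x alpha theta : 0 < alpha -> alpha * `|theta| < 1 ->
  exists2 d : R, stable_density x alpha theta = d%:C &
  `|d - stable_partial_sum N x alpha theta| <=
  pi^-1 * (`|x| ^+ N / N`!%:R *
    \int[mu]_(t in `]0, +oo[)
      (t ^+ N * expR (- (cos (pi / 2 * alpha * theta) * t `^ alpha)))).
Proof.
move=> al0 /(admissible_angle al0) psipi.
have c0 : 0 < cos (pi / 2 * alpha * theta).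
  by rewrite cos_gt0_pihalf// -ltr_norml.
eexists; first exact: stable_density_half_line.
rewrite stable_partial_sumE// -mulrBr normrM gtr0_norm ?invr_gt0 ?pi_gt0//.
by rewrite ler_wpM2l ?invr_ge0 ?pi_ge0// fourier_remainder_le.
Qed.

(** Beyond the threshold [T], where [e T^(q - p) = 1], the higher power wins; below it, [T^p] is a
    bound. It is used with exponents [1 < alpha] and with [alpha < 1]. *)
Lemma powR_le_affine p q e : 0 < p < q -> 0 < e ->
  exists C, forall t, 0 < t -> t `^ p <= e * t `^ q + C.
Proof.
move=> /andP[p0 pq] e0; have pq0 : 0 < q - p by rewrite subr_gt0.
pose T := e^-1 `^ (q - p)^-1; exists (T `^ p) => t t0.
have T0 : 0 < T by rewrite powR_gt0// invr_gt0.
have [tT|/ltW Tt] := leP t T.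
  rewrite ler_wpDl ?mulr_ge0 ?powR_ge0 ?(ltW e0)//.
  by apply: ge0_ler_powR => //; rewrite ?nnegrE ltW.
rewrite ler_wpDr ?powR_ge0//.
have -> : t `^ q = t `^ (q - p) * t `^ p.
  by rewrite -powRD ?subrK// (gt_eqF t0) implybT.
rewrite mulrA -[leLHS]mul1r ler_wpM2r ?powR_ge0//.
rewrite -(mulfV (lt0r_neq0 e0)) ler_wpM2l ?(ltW e0)//.
have <- : T `^ (q - p) = e^-1.
  by rewrite /T -powRrM mulVf ?gt_eqF// powRr1// invr_ge0 ltW.
by apply: ge0_ler_powR => //; rewrite ?nnegrE ltW.
Qed.

Lemma integrable_expn_expR n a : 0 < a ->
  mu.-integrable `]0, +oo[ (EFin \o (fun t => t ^+ n * expR (- (a * t)))).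
Proof.
move=> a0; apply: (@eq_integrable _ _ _ mu _ (measurable_itv _)
  (EFin \o (fun t => t ^+ n * expR (- (a * t `^ 1))))).
  move=> t; rewrite inE/= in_itv/= andbT => t0.
  by rewrite powRr1// ltW.
exact: integrable_expn_stretched.
Qed.

(** The affine comparison with slope [a / L] gives [L t <= a t^alpha + L C], so one constant
    [expR (L * C)] works for all moments. *)
Lemma stretched_moment_le a alpha L : 0 < a -> 1 < alpha -> 0 < L ->
  exists2 C, 0 <= C & forall n,
  \int[mu]_(t in `]0, +oo[) (t ^+ n * expR (- (a * t `^ alpha))) <=
  C * (n`!%:R / L ^+ n.+1).
Proof.
move=> a0 al1 L0; have al0 := lt_trans ltr01 al1.
have p1 : 0 < (1 : R) < alpha by rewrite ltr01 al1.
have [C CP] := powR_le_affine p1 (divr_gt0 a0 L0).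
exists (expR (L * C)) => [|n]; first exact: expR_ge0.
have I := integrable_expn_expR n L0.
rewrite -Rintegral_expn_expR// -RintegralZl//.
apply: le_Rintegral => //.
- exact: integrable_expn_stretched.
- exact: integrable_mull.
move=> t; rewrite /= in_itv/= andbT => t0.
rewrite mulrCA ler_wpM2l ?exprn_ge0 ?(ltW t0)// -expRD ler_expR.
have := CP t t0; rewrite powRr1 ?(ltW t0)// -(ler_pM2l L0) mulrDr.
by rewrite mulrA mulrCA mulfV ?gt_eqF// mulr1; lra.
Qed.

(** The affine comparison [t^alpha <= L t + C], inserted in the moment form of the gamma function,
    gives a constant independent of [n]. *)
Lemma Gamma_ge alpha L : 0 < alpha < 1 -> 0 < L ->
  exists2 k, 0 < k & forall n, k * (n`!%:R / L ^+ n.+1) <= Gamma (n.+1%:R / alpha).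
Proof.
move=> al01 L0; have /andP[al0 al1] := al01.
have [C CP] := powR_le_affine al01 L0.
exists (alpha * expR (- C)) => [|n]; first by rewrite mulr_gt0// expR_gt0.
rewrite -mulrA -ler_pdivlMl// -Rintegral_Gamma//.
have I := integrable_expn_expR n L0.
rewrite -Rintegral_expn_expR// -RintegralZl//.
apply: le_Rintegral => //.
- exact: integrable_mull.
- exact: integrable_expn_stretched1.
move=> t; rewrite /= in_itv/= andbT => t0.
rewrite mulrCA ler_wpM2l ?exprn_ge0 ?(ltW t0)// -expRD ler_expR.
by have := CP t t0; rewrite powRr1 ?(ltW t0)//; lra.
Qed.

End expansion.

(** * Divergence, closed form and convergence according to [alpha] *)

Section cases.
Context {R : realType}.
Local Notation mu := (@lebesgue_measure R).
Implicit Types (x alpha theta t psi phi : R).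

(** The general term does not tend to 0: its size is at least a constant times
    [|sin (phi (n + 1))|], and two consecutive such sines cannot both be small because
    [sin phi > 0]. *)
Lemma stable_partial_sum_diverges alpha theta x : 0 < alpha < 1 ->
  `|theta| < 1 -> x != 0 -> ~ cvgn (fun N => stable_partial_sum N x alpha theta).
Proof.
move=> al01 th1 x0 cv; have /andP[al0 al1] := al01.
pose phi := pi / 2 * (1 - theta).
have sphi : 0 < sin phi.
  move: th1; rewrite ltr_norml => /andP[th0 th1].
  have p2 : 0 < pi / 2 :> R by rewrite divr_gt0// pi_gt0.
  apply: sin_gt0_pi; rewrite mulr_gt0 ?subr_gt0//=.
  have : pi / 2 * (1 - theta) < pi / 2 * 2 by rewrite ltr_pM2l//; lra.
  by rewrite divfK.
pose u n := x ^+ n / n`!%:R * Gamma (n.+1%:R / alpha) *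
  sin (pi / 2 * n.+1%:R * (1 - theta)).
have ap0 : alpha * pi != 0 by rewrite mulf_neq0 ?gt_eqF ?pi_gt0.
have u0 : u n @[n --> \oo] --> 0.
  apply: cvg_series_cvg_0.
  rewrite (_ : series u = (fun N => alpha * pi * stable_partial_sum N x alpha theta)).
    exact: is_cvgMr.
  by apply/funext => N; rewrite /stable_partial_sum mulrA mulfV// mul1r.
have x0' : 0 < `|x| by rewrite normr_gt0.
(* With [L = |x|] the lower bound of the gamma factor cancels [|x|^n / n!] and leaves [k / |x|]. *)
have [k k0 kP] := Gamma_ge al01 x0'.
have ule n : k / `|x| * `|sin (phi * n.+1%:R)| <= `|u n|.
  have -> : phi * n.+1%:R = pi / 2 * n.+1%:R * (1 - theta) by rewrite /phi; ring.
  rewrite /u normrM ler_wpM2r// normrM normrM normrX normfV normr_nat.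
  have xnf : 0 <= `|x| ^+ n / n`!%:R by rewrite divr_ge0// exprn_ge0.
  apply: le_trans (ler_wpM2l xnf (le_trans (kP n) (ler_norm _))).
  have f0 : n`!%:R != 0 :> R by rewrite pnatr_eq0 -lt0n fact_gt0.
  have xn0 : `|x| ^+ n != 0 by rewrite expf_neq0// gt_eqF.
  rewrite exprS le_eqVlt; apply/orP; left; apply/eqP.
  move: (`|x| ^+ n) xn0 => y y0; have := gt_eqF x0'; move: (`|x|) => z z0.
  by field; rewrite f0 y0 z0.
pose e := k / `|x| * (sin phi / 2).
have e0 : 0 < e by rewrite mulr_gt0 ?divr_gt0.
move/cvgr0Pnorm_lt : u0 => /(_ e e0)[n0 _ un0].
have small n : (n0 <= n)%N -> `|sin (phi * n.+1%:R)| < sin phi / 2.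
  move=> nn0; rewrite -(@ltr_pM2l _ (k / `|x|)) ?divr_gt0//.
  by rewrite (le_lt_trans (ule n))// un0.
have s1 := small n0 (leqnn _); have s2 := small n0.+1 (leqnSn _).
(* Since [phi] is the difference of two consecutive angles, the subtraction formula bounds [sin phi]
   by a sum of two terms, each below [sin phi / 2]. *)
have : sin phi <= `|sin (phi * n0.+2%:R)| + `|sin (phi * n0.+1%:R)|.
  have -> : sin phi = sin (phi * n0.+2%:R - phi * n0.+1%:R).
    by congr sin; rewrite -(@natr1 _ n0.+1); ring.
  rewrite sinB (le_trans (ler_norm _))// (le_trans (ler_normB _ _))// !normrM.
  by apply: lerD; [rewrite ler_piMr ?cos_max|rewrite ler_piMl ?cos_max].
by lra.
Qed.

(** The sines satisfy [sin ((n+2) phi) = 2 cos phi sin ((n+1) phi) - sin (n phi)]; multiplying by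
    the matching quadratic in [x] makes the sum telescope. *)
Lemma sin_geometric_sum phi x N :
  (\sum_(0 <= n < N) sin (phi * n.+1%:R) * x ^+ n) * (1 - 2 * x * cos phi + x ^+ 2) =
  sin phi - x ^+ N * sin (phi * N.+1%:R) + x ^+ N.+1 * sin (phi * N%:R).
Proof.
elim: N => [|N IH].
  by rewrite big_nil mul0r expr0 mul1r mulr1 subrr mulr0 sin0 mulr0 addr0.
have H : sin (phi * N.+2%:R) = 2 * cos phi * sin (phi * N.+1%:R) - sin (phi * N%:R).
  have -> : phi * N.+2%:R = phi * N.+1%:R + phi by rewrite -(@natr1 _ N.+1); ring.
  have -> : phi * N%:R = phi * N.+1%:R - phi by rewrite -(@natr1 _ N); ring.
  by rewrite sinD sinB; ring.
by rewrite big_nat_recr//= mulrDl IH H !exprS; ring.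
Qed.

Lemma sin_geometric_series phi x : `|x| < 1 ->
  series (fun n => sin (phi * n.+1%:R) * x ^+ n) @ \oo -->
  sin phi / (1 - 2 * x * cos phi + x ^+ 2).
Proof.
move=> x1.
(* The denominator is at least [(1 - |x|)^2]. *)
have D0 : 0 < 1 - 2 * x * cos phi + x ^+ 2.
  have h : x * cos phi <= `|x|.
    by rewrite (le_trans (ler_norm _))// normrM ler_piMr// cos_max.
  have h2 : 0 < (1 - `|x|) ^+ 2 by rewrite exprn_gt0// subr_gt0.
  rewrite -(real_normK (num_real x)) (lt_le_trans h2)//.
  by rewrite sqrrB; lra.
have bnd (v : nat -> R) : (forall n, `|v n| <= 1) -> x ^+ n * v n @[n --> \oo] --> 0.
  move=> v1; apply: (@squeeze_norm0 _ _ _ _ _ (fun n => `|x| ^+ n)).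
    by near=> n; rewrite normrM normrX ler_piMr// exprn_ge0.
  by apply: cvg_expr; rewrite normr_id.
rewrite (_ : series _ = (fun N =>
  (sin phi - x ^+ N * sin (phi * N.+1%:R) + x * (x ^+ N * sin (phi * N%:R))) /
  (1 - 2 * x * cos phi + x ^+ 2))); last first.
  apply/funext => N; apply: (mulIf (lt0r_neq0 D0)).
  by rewrite mulfVK ?(lt0r_neq0 D0)// [LHS]sin_geometric_sum exprS mulrA.
rewrite (_ : sin phi / _ = (sin phi - 0 + x * 0) / (1 - 2 * x * cos phi + x ^+ 2)).
  2: by rewrite mulr0 addr0 subr0.
apply: cvgMl; apply: cvgD; last by apply: cvgMr; apply: bnd => n; exact: sin_max.
by apply: cvgB; [exact: cvg_cst|apply: bnd => n; exact: sin_max].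
Unshelve. all: end_near. Qed.

Lemma stable_partial_sum1E N x theta :
  stable_partial_sum N x 1 theta =
  pi^-1 * \sum_(0 <= n < N) (sin (pi / 2 * (1 - theta) * n.+1%:R) * x ^+ n).
Proof.
rewrite /stable_partial_sum mul1r; congr (_ * _); apply: eq_bigr => n _.
rewrite divr1 Gamma_nat mulfVK ?pnatr_eq0 -?lt0n ?fact_gt0// mulrC.
by congr (sin _ * _); ring.
Qed.

(** With [a = cos psi] and [k = sin psi - x], the integral is the real part of that of
    [exp(- (a - i k) t)], namely of [1 / (a - i k)]. *)
Lemma half_line_fourier1 psi x : 0 < cos psi ->
  half_line_fourier 1 psi x = cos psi / (cos psi ^+ 2 + (sin psi - x) ^+ 2).
Proof.
move=> a0; set a := cos psi; set k := sin psi - x.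
have D0 : 0 < a ^+ 2 + k ^+ 2 by rewrite ltr_wpDr ?sqr_ge0 ?exprn_gt0.
pose f t : R := expR (- (a * t)) * cos (k * t).
(* The real part of [- exp(- (a - i k) t) / (a - i k)]. *)
pose F t : R := (a ^+ 2 + k ^+ 2)^-1 *
  (expR (- (a * t)) * (k * sin (k * t) - a * cos (k * t))).
have dF t : is_derive t 1 F (f t).
  apply: is_derive_eq; rewrite /GRing.scale/= /f.
  by field; rewrite gt_eqF.
have cf : {in `]0, +oo[, continuous f}.
  by move=> t _; apply: is_derive_continuous.
have fE t : 0 < t -> expR (- (t `^ 1 * cos psi)) * cos (t `^ 1 * sin psi - t * x) = f t.
  move=> t0; rewrite powRr1 ?(ltW t0)// /f /k mulrC [in RHS]mulrC (mulrC t (cos _)).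
  by congr (cos _ * _); ring.
have If : mu.-integrable `]0, +oo[ (EFin \o f).
  apply: (integrable_stretched (p := 0) (K := 1) cf _ a0 ltr01) => //.
  move=> t t0; rewrite powRr0 !mul1r powRr1 ?(ltW t0)// /f normrM (ger0_norm (expR_ge0 _)).
  by rewrite ler_piMr ?expR_ge0 ?cos_max.
have -> : half_line_fourier 1 psi x = \int[mu]_(t in `]0, +oo[) f t.
  by apply: eq_Rintegral => t; rewrite inE/= in_itv/= andbT; exact: fE.
rewrite (Rintegral_oy_FTC (F := F) (l := 0) (l0 := F 0) If cf (fun t _ => dF t)).
- rewrite /F !mulr0 oppr0 expR0 sin0 cos0; field; exact: lt0r_neq0.
- by apply: cvg_at_right_filter; exact: is_derive_continuous (dF 0).
apply: (@squeeze_norm0 _ _ _ _ _ (fun t =>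
   (a ^+ 2 + k ^+ 2)^-1 * (`|k| + `|a|) * (t `^ 0 * expR (- (a * t `^ 1))))).
  near=> t; have t0 : 0 < t by [].
  rewrite /F normrM normfV (gtr0_norm D0) -mulrA ler_wpM2l ?invr_ge0 ?(ltW D0)//.
  rewrite normrM (ger0_norm (expR_ge0 _)) powRr0 mul1r powRr1 ?(ltW t0)// mulrC.
  rewrite ler_wpM2r ?expR_ge0// (le_trans (ler_normB _ _))// !normrM.
  by rewrite lerD// ler_piMr ?sin_max ?cos_max.
rewrite -[X in _ --> X](mulr0 ((a ^+ 2 + k ^+ 2)^-1 * (`|k| + `|a|))).
by apply: cvgMr; exact: stretched_cvgy.
Unshelve. all: end_near. Qed.

Lemma stable_density_bigO alpha theta N : 0 < alpha -> alpha * `|theta| < 1 ->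
  (fun x : R => stable_density x alpha theta : R[i]^o) =
  (fun x : R => (stable_partial_sum N x alpha theta)%:C : R[i]^o)
    +O_ (0 : R) (fun x : R => (x ^+ N)%:C : R[i]^o).
Proof.
move=> al0 alth; apply/eqaddOP; apply/bigO_exP.
pose M := \int[mu]_(t in `]0, +oo[)
      (t ^+ N * expR (- (cos (pi / 2 * alpha * theta) * t `^ alpha))).
have M0 : 0 <= M.
  apply: Rintegral_ge0 => t /=; rewrite in_itv/= andbT => t0.
  by rewrite mulr_ge0 ?expR_ge0// exprn_ge0// ltW.
(* The norm of [R[i]] takes its values in [R[i]], so the real estimate has to be carried along the
   embedding. *)
have normcR (y : R) : `|y%:C : R[i]| = (`|y|)%:C.
  by rewrite normc_def/= expr0n/= addr0 sqrtr_sqr.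
(* Adding 1 makes the constant strictly positive, as the witness of a big-O must be. *)
pose c := pi^-1 * (M / N`!%:R) + 1.
have c0 : 0 < c.
  by rewrite ltr_wpDl// mulr_ge0 ?divr_ge0// invr_ge0 pi_ge0.
exists c%:C; first by rewrite ltcR.
near=> x.
have [d dE dle] := stable_density_remainder N x al0 alth.
have -> : ((fun x0 : R => stable_density x0 alpha theta : R[i]^o) -
  (fun x0 : R => (stable_partial_sum N x0 alpha theta)%:C : R[i]^o)) x =
  (d - stable_partial_sum N x alpha theta)%:C.
  by rewrite rmorphB/= -dE.
rewrite !normcR -rmorphM lecR (le_trans dle)// -/M normrX /c mulrDl mul1r.
rewrite ler_wpDr ?exprn_ge0// le_eqVlt; apply/orP; left; apply/eqP; ring.
Unshelve. all: end_near. Qed.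

(** The moment bound contributes [N! / L^(N+1)], which cancels the factorial of the Taylor error and
    leaves a multiple of [(|x| / L)^N]. *)
Lemma stable_density_entire alpha theta x : 1 < alpha -> alpha * `|theta| < 1 ->
  exists2 d : R, stable_density x alpha theta = d%:C &
  stable_partial_sum N x alpha theta @[N --> \oo] --> d.
Proof.
move=> al1 alth; have al0 := lt_trans ltr01 al1.
have c0 : 0 < cos (pi / 2 * alpha * theta).
  by rewrite cos_gt0_pihalf// -ltr_norml admissible_angle.
(* Order 0 serves to extract the real value [d]; the value obtained at each order [N] is later
   identified with it. *)
have [d dE _] := stable_density_remainder 0 x al0 alth.
(* This [L] is positive and exceeds [|x|], also when [x = 0]. *)
exists d => //; pose L := `|x| * 2 + 1.
have L0 : 0 < L by rewrite ltr_wpDl// mulr_ge0.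
have [C C0 CP] := stretched_moment_le c0 al1 L0.
apply/cvgrPdist_le => /= e e0.
have q1 : `| (`|x| / L) | < 1.
  rewrite ger0_norm ?divr_ge0 ?(ltW L0)// ltr_pdivrMr// mul1r /L.
  by have := normr_ge0 x; lra.
have K0 : 0 <= pi^-1 * C / L by rewrite !mulr_ge0 ?invr_ge0 ?pi_ge0 ?(ltW L0).
have : (pi^-1 * C / L * (`|x| / L) ^+ n) @[n --> \oo] --> (0 : R).
  by rewrite -[X in _ --> X](mulr0 (pi^-1 * C / L)); apply: cvgMr; exact: cvg_expr.
move/cvgr0Pnorm_le => /(_ e e0); apply: filterS => N.
apply: le_trans; rewrite (le_trans _ (ler_norm _))//.
have [b bE] := stable_density_remainder N x al0 alth.
have -> : b = d by move: bE; rewrite dE => -[].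
move/le_trans; apply.
rewrite -[leRHS]mulrA -[leRHS]mulrA ler_wpM2l ?invr_ge0 ?pi_ge0//.
have f0 : 0 < N`!%:R :> R by rewrite ltr0n fact_gt0.
have xf : 0 <= `|x| ^+ N / N`!%:R by rewrite divr_ge0 ?exprn_ge0.
rewrite (le_trans (ler_wpM2l xf (CP N)))// le_eqVlt; apply/orP; left; apply/eqP.
rewrite expr_div_n exprS; have LN0 : L ^+ N != 0 by rewrite expf_neq0// gt_eqF.
move: (L ^+ N) LN0 => y y0; move: (`|x| ^+ N) => z.
by field; rewrite y0 !gt_eqF.
Qed.
End cases.

(** Divergence is asserted away from [x = 0], where only the constant term survives, and away from
    [theta = 1] and [theta = -1], where all the sines vanish. *)
Theorem corollary1 (R : realType) :
  (* alpha < 1 *)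
  (forall alpha theta : R, admissible alpha theta -> alpha < 1 ->
     (forall x : R, x != 0 -> `|theta| != 1 ->
        ~ cvgn (fun N => stable_partial_sum N x alpha theta)) /\
     (forall N : nat,
        (fun x : R => stable_density x alpha theta : R[i]^o) =
        (fun x : R => (stable_partial_sum N x alpha theta)%:C : R[i]^o)
          +O_ (0 : R) (fun x : R => (x ^+ N)%:C : R[i]^o)))
  /\
  (* alpha = 1 *)
  (forall theta x : R, admissible 1 theta -> `|x| < 1 ->
     cvgn (fun N => stable_partial_sum N x 1 theta) /\
     (theta != 1 -> theta != -1 ->
        cvgn (series (fun n : nat =>
                sin (pi / 2 * n.+1%:R * (1 - theta)) * x ^+ n)) /\
        stable_density x 1 theta =
          (pi^-1 * limn (series (fun n : nat =>
                sin (pi / 2 * n.+1%:R * (1 - theta)) * x ^+ n)))%:C))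
  /\
  (* alpha > 1 *)
  (forall alpha theta x : R, admissible alpha theta -> 1 < alpha ->
     cvgn (fun N => stable_partial_sum N x alpha theta) /\
     stable_density x alpha theta =
       (limn (fun N => stable_partial_sum N x alpha theta))%:C).
Proof.
split; [|split].
- move=> alpha theta [/andP[al0 _]]; rewrite le_min => /andP[th1 _] al1; split.
    move=> x x0 thN1; apply: stable_partial_sum_diverges => //; first by rewrite al0.
    by rewrite lt_neqAle thN1.
  move=> N; apply: stable_density_bigO => //.
  by rewrite (le_lt_trans _ al1)// ler_piMr// ltW.
- move=> theta x [_]; rewrite le_min => /andP[th1 _] x1.
  set phi := pi / 2 * (1 - theta).
  have uE : (fun n : nat => sin (pi / 2 * n.+1%:R * (1 - theta)) * x ^+ n) =
      (fun n => sin (phi * n.+1%:R) * x ^+ n).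
    by apply/funext => n; congr (sin _ * _); rewrite /phi; ring.
  have S := @sin_geometric_series R phi x x1.
  split.
    under eq_fun do rewrite stable_partial_sum1E.
    by apply: is_cvgMr; exact: cvgP S.
  move=> thN1 thNN1; rewrite uE; split; first exact: cvgP S.
  have th1' : 1 * `|theta| < 1.
    rewrite mul1r lt_neqAle th1 andbT; apply/negP => /eqP th.
    have [t0|t0] := leP 0 theta.
      by rewrite -(ger0_norm t0) th eqxx in thN1.
    by rewrite -[theta]opprK -(ltr0_norm t0) th eqxx in thNN1.
  have c0 : 0 < cos (pi / 2 * 1 * theta).
    by rewrite cos_gt0_pihalf// -ltr_norml admissible_angle.
  rewrite stable_density_half_line// half_line_fourier1// (cvg_lim _ S)//.
  (* With [psi = pi theta / 2] and [phi = pi / 2 - psi], sine and cosine are exchanged, and both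
     denominators equal [1 - 2 x sin psi + x^2]. *)
  rewrite mulr1; have -> : phi = pi / 2 - pi / 2 * theta by rewrite /phi; ring.
  rewrite sinB cosB sin_pihalf cos_pihalf !mul0r !mul1r add0r subr0.
  congr (_ * (_ / _))%:C.
  by rewrite cos2sin2; ring.
- move=> alpha theta x [/andP[al0 al2]]; rewrite le_min => /andP[_ th2] al1.
  (* Admissibility gives [alpha |theta| <= 2 - alpha], which is below 1 here. *)
  have alth : alpha * `|theta| < 1.
    have := ler_wpM2l (ltW al0) th2.
    rewrite mulrBr mulr1 mulrCA mulfV ?gt_eqF// mulr1; lra.
  have [d -> S] := stable_density_entire x al1 alth.
  by split; [exact: cvgP S|rewrite (cvg_lim _ S)].
Qed.
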